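(* $\mathsf{RCA}_0^\omega$ proves $\mathsf{Korg}_1\to\mathsf{NBI}$.
   Context: Framework: Kohlenbach's higher-order arithmetic; $\mathsf{RCA}_0^\omega$ is the base theory (ordered semiring axioms, combinators/$\lambda$-abstraction, primitive recursion $\mathbf R_0$, extensionality at all finite types, quantifier-free induction, $\mathsf{QF\text{-}AC}^{1,0}$). Reals are fast-converging Cauchy sequences of rationals with equality $=_{\mathbb R}$. A set $A\subseteq\mathbb R$ is an arbitrary function $A:\mathbb R\to\mathbb R$ with $x\in A$ meaning $A(x)>0$; countable if there is $Y:\mathbb R\to\mathbb N$ with $(\forall x,y\in A)(Y(x)=Y(y)\to x=_{\mathbb R}y)$, strongly countable if moreover $(\forall n)(\exists x\in A)(Y(x)=n)$; finite if there are $k$ and $Y:\mathbb R\to\mathbb N$ injective on $A$ with values in $\{0,\dots,k\}$ on $A$. $\mathsf{Korg}_1$ (K\''onig's infinity lemma for graphs, strongly countable version): let $G\subseteq\mathbb R$ be an infinite strongly countable set (the vertices), $R$ a symmetric binary relation on $\mathbb R$ (the edges, given by a functional), and $(E_n)_{n\ge1}$ a sequence of non-empty finite subsets of $G$ (given by a functional $E(n,x)$) with $G=\bigcup_nE_n$, such that every point of $E_{n+1}$ is $R$-related to some point of $E_n$. Then there is a sequence $(a_n)_{n\ge1}$ with $a_n\in E_n$ and $a_nRa_{n+1}$ for all $n$. $\mathsf{NBI}$: for every $Y:[0,1]\to\mathbb N$, either there are $x,y\in[0,1]$ with $x\ne_{\mathbb R}y$ and $Y(x)=Y(y)$, or there is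 $N$ with $(\forall x\in[0,1])(Y(x)\ne N)$. *)

(* Defs.v *)
From Stdlib Require Import List.
Import ListNotations.

Set Implicit Arguments.
Unset Strict Implicit.
Unset Printing Implicit Defensive.

Declare Scope ty_scope.
Delimit Scope ty_scope with ty.
Declare Scope tm_scope.
Delimit Scope tm_scope with tm.
Declare Scope fm_scope.
Delimit Scope fm_scope with fm.

Inductive ty : Set := tO | Arr (σ τ : ty).
Bind Scope ty_scope with ty.
Notation "σ ⇾ τ" := (Arr σ τ) (at level 60, right associativity) : ty_scope.

Definition t1 : ty := Arr tO tO.
Definition t2 : ty := Arr t1 tO.

(* A context is a family [V] of sets of variables, one for each type; a closed
   expression is one over [noVar].  A binder adds one variable to [V]: in
   [ext V σ] the newest variable is [new], and [old] embeds those of [V]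
   (well-scoped de Bruijn indices). *)
Inductive noVar : ty -> Set := .

Inductive ext (V : ty -> Set) (σ : ty) : ty -> Set :=
| new : ext V σ σ
| old τ (v : V τ) : ext V σ τ.
Arguments new {V σ}.
Arguments old {V σ τ} v.

Inductive cst : ty -> Set :=
| c0 : cst tO
| c1 : cst tO
| cAdd : cst (tO ⇾ tO ⇾ tO)
| cMul : cst (tO ⇾ tO ⇾ tO)
| cK σ τ : cst (σ ⇾ τ ⇾ σ)                                 (* Π *)
| cS ρ σ τ : cst ((ρ ⇾ σ ⇾ τ) ⇾ (ρ ⇾ σ) ⇾ ρ ⇾ τ)          (* Σ *)
| cRec : cst ((tO ⇾ tO ⇾ tO) ⇾ tO ⇾ tO ⇾ tO).              (* R_0 *)

Inductive tm (V : ty -> Set) : ty -> Set :=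
| Var τ (v : V τ) : tm V τ
| Cst τ (c : cst τ) : tm V τ
| App σ τ (f : tm V (σ ⇾ τ)) (s : tm V σ) : tm V τ.
Arguments Var {V τ} v.
Arguments Cst {V τ} c.
Arguments App {V σ τ} f%_tm s%_tm.
Bind Scope tm_scope with tm.

Inductive fm (V : ty -> Set) : Type :=
| Eq (s t : tm V tO)
| Lt (s t : tm V tO)
| Bot
| Imp (φ ψ : fm V)
| And (φ ψ : fm V)
| Or (φ ψ : fm V)
| All σ (φ : fm (ext V σ))
| Ex σ (φ : fm (ext V σ)).
Arguments Bot {V}.
Arguments All {V} σ%_ty φ%_fm.
Arguments Ex {V} σ%_ty φ%_fm.
Bind Scope fm_scope with fm.

Definition Not V (φ : fm V) : fm V := Imp φ Bot.
Definition Iff V (φ ψ : fm V) : fm V := And (Imp φ ψ) (Imp ψ φ).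
Definition Le V (s t : tm V tO) : fm V := Or (Lt s t) (Eq s t).

Notation "f · s" := (App f s) (at level 11, left associativity) : tm_scope.
Notation "0" := (Cst c0) : tm_scope.
Notation "1" := (Cst c1) : tm_scope.
Notation "s + t" := (Cst cAdd · s · t)%tm : tm_scope.
Notation "s * t" := (Cst cMul · s · t)%tm : tm_scope.
Notation "'#0'" := (Var new) : tm_scope.
Notation "'#1'" := (Var (old new)) : tm_scope.
Notation "'#2'" := (Var (old (old new))) : tm_scope.

Notation "s ≐ t" := (Eq s%tm t%tm) (at level 70) : fm_scope.
Notation "s ≺ t" := (Lt s%tm t%tm) (at level 70) : fm_scope.
Notation "s ≼ t" := (Le s%tm t%tm) (at level 70) : fm_scope.
Notation "⊥" := Bot : fm_scope.
Notation "¬ φ" := (Not φ) (at level 75, right associativity) : fm_scope.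
Notation "φ ∧ ψ" := (And φ ψ) (at level 80, right associativity) : fm_scope.
Notation "φ ∨ ψ" := (Or φ ψ) (at level 85, right associativity) : fm_scope.
Notation "φ ⟶ ψ" := (Imp φ ψ) (at level 90, right associativity) : fm_scope.
Notation "φ ⟷ ψ" := (Iff φ ψ) (at level 95) : fm_scope.
Notation "∀[ σ ] φ" := (All σ φ) (at level 100, φ at level 200) : fm_scope.
Notation "∃[ σ ] φ" := (Ex σ φ) (at level 100, φ at level 200) : fm_scope.

Definition ren (V W : ty -> Set) : Set := forall τ, V τ -> W τ.
Definition sub (V W : ty -> Set) : Set := forall τ, V τ -> tm W τ.

Fixpoint tren V W (r : ren V W) τ (s : tm V τ) : tm W τ :=
  match s with
  | Var v => Var (r _ v)
  | Cst c => Cst c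
  | App f s => App (tren r f) (tren r s)
  end.

Definition rlift V W σ (r : ren V W) : ren (ext V σ) (ext W σ) :=
  fun _ v => match v with new => new | old v => old (r _ v) end.

Fixpoint fren V W (r : ren V W) (φ : fm V) : fm W :=
  match φ with
  | Eq s t => Eq (tren r s) (tren r t)
  | Lt s t => Lt (tren r s) (tren r t)
  | Bot => Bot
  | Imp φ ψ => Imp (fren r φ) (fren r ψ)
  | And φ ψ => And (fren r φ) (fren r ψ)
  | Or φ ψ => Or (fren r φ) (fren r ψ)
  | All σ φ => All σ (fren (rlift r) φ)
  | Ex σ φ => Ex σ (fren (rlift r) φ)
  end.

Definition twk V σ τ (s : tm V τ) : tm (ext V σ) τ := tren (fun _ v => old v) s.
Definition fwk V σ (φ : fm V) : fm (ext V σ) := fren (fun _ v => old v) φ.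
Notation "s ↑" := (twk _ s) (at level 2, left associativity, format "s ↑") : tm_scope.

Fixpoint tsub V W (r : sub V W) τ (s : tm V τ) : tm W τ :=
  match s with
  | Var v => r _ v
  | Cst c => Cst c
  | App f s => App (tsub r f) (tsub r s)
  end.

Definition slift V W σ (r : sub V W) : sub (ext V σ) (ext W σ) :=
  fun _ v => match v with new => Var new | old v => twk σ (r _ v) end.

Fixpoint fsub V W (r : sub V W) (φ : fm V) : fm W :=
  match φ with
  | Eq s t => Eq (tsub r s) (tsub r t)
  | Lt s t => Lt (tsub r s) (tsub r t)
  | Bot => Bot
  | Imp φ ψ => Imp (fsub r φ) (fsub r ψ)
  | And φ ψ => And (fsub r φ) (fsub r ψ)
  | Or φ ψ => Or (fsub r φ) (fsub r ψ)
  | All σ φ => All σ (fsub (slift r) φ)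
  | Ex σ φ => Ex σ (fsub (slift r) φ)
  end.

Definition scons V W σ (s : tm W σ) (r : sub V W) : sub (ext V σ) W :=
  fun _ v => match v in ext _ _ τ return tm W σ -> tm W τ with
             | new => fun s => s
             | old v => fun _ => r _ v
             end s.

Definition inst V σ (s : tm V σ) (φ : fm (ext V σ)) : fm V :=
  fsub (scons s (fun _ v => Var v)) φ.

(* [T] gives the non-logical axioms; the free variables of an axiom are read
   universally. *)
Inductive prv (T : forall V, fm V -> Prop) (V : ty -> Set) (Γ : list (fm V)) :
  fm V -> Prop :=
| prvT φ : T V φ -> prv T Γ φ
| prvHyp φ : In φ Γ -> prv T Γ φ
| prvII φ ψ : prv T (φ :: Γ) ψ -> prv T Γ (φ ⟶ ψ)
| prvIE φ ψ : prv T Γ (φ ⟶ ψ) -> prv T Γ φ -> prv T Γ ψ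
| prvAI φ ψ : prv T Γ φ -> prv T Γ ψ -> prv T Γ (φ ∧ ψ)
| prvAE1 φ ψ : prv T Γ (φ ∧ ψ) -> prv T Γ φ
| prvAE2 φ ψ : prv T Γ (φ ∧ ψ) -> prv T Γ ψ
| prvOI1 φ ψ : prv T Γ φ -> prv T Γ (φ ∨ ψ)
| prvOI2 φ ψ : prv T Γ ψ -> prv T Γ (φ ∨ ψ)
| prvOE φ ψ χ : prv T Γ (φ ∨ ψ) -> prv T (φ :: Γ) χ -> prv T (ψ :: Γ) χ ->
                prv T Γ χ
| prvRAA φ : prv T ((¬ φ) :: Γ)%fm ⊥ -> prv T Γ φ
| prvUI σ φ : prv T (map (fwk σ) Γ) φ -> prv T Γ (∀[σ] φ)
| prvUE σ φ (s : tm V σ) : prv T Γ (∀[σ] φ) -> prv T Γ (inst s φ)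
| prvEI σ φ (s : tm V σ) : prv T Γ (inst s φ) -> prv T Γ (∃[σ] φ)
| prvEE σ φ ψ : prv T Γ (∃[σ] φ) -> prv T (φ :: map (fwk σ) Γ) (fwk σ ψ) ->
                prv T Γ ψ.

(* Equality at higher types is the defined, pointwise one. *)
Fixpoint EqT (τ : ty) : forall V, tm V τ -> tm V τ -> fm V :=
  match τ with
  | tO => fun V s t => Eq s t
  | Arr σ τ => fun V s t => All σ (EqT (s↑ · #0)%tm (t↑ · #0)%tm)
  end.
Notation "s ≗ t" := (EqT s%tm t%tm) (at level 70) : fm_scope.

Fixpoint qf V (φ : fm V) : Prop :=
  match φ with
  | Eq _ _ | Lt _ _ | Bot => True
  | Imp φ ψ | And φ ψ | Or φ ψ => qf φ /\ qf ψ
  | All _ _ | Ex _ _ => False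
  end.

Definition instS V (φ : fm (ext V tO)) : fm (ext V tO) :=
  fsub (scons (#0 + 1)%tm (fun _ v => Var (old v))) φ.

(* For [φ] with newest variable y^0 and second newest variable x^1, this is
   φ(x, Y(x)), with newest variable x and second newest variable Y. *)
Definition instY V (φ : fm (ext (ext V t1) tO)) : fm (ext (ext V t2) t1) :=
  fsub (scons (#1 · #0)%tm (scons #0%tm (fun _ v => Var (old (old v))))) φ.

Local Open Scope fm_scope.

Inductive RCA0w (V : ty -> Set) : fm V -> Prop :=
| ax_refl x : RCA0w (x ≐ x)
| ax_sym x y : RCA0w (x ≐ y ⟶ y ≐ x)
| ax_trans x y z : RCA0w (x ≐ y ⟶ y ≐ z ⟶ x ≐ z)
| ax_ltE x x' y y' : RCA0w (x ≐ x' ⟶ y ≐ y' ⟶ x ≺ y ⟶ x' ≺ y')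
| ax_addC x y : RCA0w (x + y ≐ y + x)
| ax_addA x y z : RCA0w (x + (y + z) ≐ (x + y) + z)
| ax_add0 x : RCA0w (x + 0 ≐ x)
| ax_mulC x y : RCA0w (x * y ≐ y * x)
| ax_mulA x y z : RCA0w (x * (y * z) ≐ (x * y) * z)
| ax_mul1 x : RCA0w (x * 1 ≐ x)
| ax_mul0 x : RCA0w (x * 0 ≐ 0)
| ax_mulD x y z : RCA0w (x * (y + z) ≐ x * y + x * z)
| ax_ltirr x : RCA0w (¬ x ≺ x)
| ax_lttrans x y z : RCA0w (x ≺ y ⟶ y ≺ z ⟶ x ≺ z)
| ax_lttotal x y : RCA0w (x ≺ y ∨ x ≐ y ∨ y ≺ x)
| ax_ltadd x y z : RCA0w (x ≺ y ⟶ x + z ≺ y + z)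
| ax_ltmul x y z : RCA0w (0 ≺ z ⟶ x ≺ y ⟶ x * z ≺ y * z)
| ax_lt01 : RCA0w (0 ≺ 1)
| ax_ge0 x : RCA0w (0 ≼ x)
| ax_discr x y : RCA0w (x ≺ y + 1 ⟶ x ≼ y)
| ax_K σ τ (x : tm V σ) (y : tm V τ) : RCA0w (Cst (cK σ τ) · x · y ≗ x)
| ax_S ρ σ τ (x : tm V (ρ ⇾ σ ⇾ τ)) (y : tm V (ρ ⇾ σ)) (z : tm V ρ) :
    RCA0w (Cst (cS ρ σ τ) · x · y · z ≗ x · z · (y · z))
| ax_rec0 f m : RCA0w (Cst cRec · f · m · 0 ≐ m)
| ax_recS f m n :
    RCA0w (Cst cRec · f · m · (n + 1) ≐ f · n · (Cst cRec · f · m · n))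
| ax_ext ρ τ (x y : tm V ρ) (f : tm V (ρ ⇾ τ)) :
    RCA0w (x ≗ y ⟶ f · x ≗ f · y)
| ax_ind (φ : fm (ext V tO)) :
    qf φ ->
    RCA0w (inst 0 φ ∧ (∀[tO] φ ⟶ instS φ) ⟶ ∀[tO] φ)
| ax_qfac (φ : fm (ext (ext V t1) tO)) :
    qf φ ->
    RCA0w ((∀[t1] ∃[tO] φ) ⟶ ∃[t2] ∀[t1] instY φ).

Definition RCA0w_proves (φ : fm noVar) : Prop := prv RCA0w [] φ.

(* λ-abstraction by the usual bracket translation into combinators. *)
Fixpoint lam V σ τ (s : tm (ext V σ) τ) : tm V (σ ⇾ τ) :=
  match s with
  | Var v =>
      match v in ext _ _ τ return tm V (σ ⇾ τ) with
      | new => Cst (cS σ (σ ⇾ σ) σ) · Cst (cK σ (σ ⇾ σ)) · Cst (cK σ σ)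
      | old v => Cst (cK _ σ) · Var v
      end
  | Cst c => Cst (cK _ σ) · Cst c
  | App f s => Cst (cS _ _ _) · lam f · lam s
  end%tm.

(* [iter m s n] is R_0(λi.λr.s, m, n) with i = #1, r = #0. *)
Definition iter V (m : tm V tO) (s : tm (ext (ext V tO) tO) tO) (n : tm V tO) :
  tm V tO := (Cst cRec · lam (lam s) · m · n)%tm.

Local Open Scope tm_scope.

Definition num V (n : nat) : tm V tO := Nat.iter n (fun s => s + 1) 0.
Arguments num {V} n.
Definition exp2 V (n : tm V tO) : tm V tO := iter 1 (#0 + #0) n.
Definition predN V (n : tm V tO) : tm V tO := iter 0 #1 n.
Definition monus V (m n : tm V tO) : tm V tO := iter m (predN #0) n.
Definition parity V (n : tm V tO) : tm V tO := iter 0 (monus 1 #0) n.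
Definition half V (n : tm V tO) : tm V tO := iter 0 (#0 + parity #1) n.
(* n(n+1)/2 *)
Definition tri V (n : tm V tO) : tm V tO := iter 0 (#0 + (#1 + 1)) n.
(* the largest w such that tri w <= n *)
Definition triroot V (n : tm V tO) : tm V tO :=
  iter 0 (#0 + monus 1 (monus (tri (#0 + 1)) (#1 + 1))) n.

(* Cantor pairing; [fstN] and [sndN] are its projections. *)
Definition pairN V (m n : tm V tO) : tm V tO := tri (m + n) + m.
Definition fstN V (q : tm V tO) : tm V tO := monus q (tri (triroot q)).
Definition sndN V (q : tm V tO) : tm V tO := monus (triroot q) (fstN q).

(* Every number codes a rational: pairN (2a) b codes a/(b+1), and
   pairN (2a+1) b codes -(a+1)/(b+1).  The rational coded by q is
   (pos q - neg q) / den q. *)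
Definition pos V (q : tm V tO) : tm V tO :=
  monus 1 (parity (fstN q)) * half (fstN q).
Definition neg V (q : tm V tO) : tm V tO :=
  parity (fstN q) * half (fstN q + 1).
Definition den V (q : tm V tO) : tm V tO := sndN q + 1.

Local Open Scope fm_scope.

(* q - r <_Q c 2^-n,  q - r <=_Q c 2^-n  and  q - r >_Q c 2^-n *)
Definition diff_lt V (q r c n : tm V tO) : fm V :=
  exp2 n * (pos q * den r + neg r * den q) ≺
  exp2 n * (pos r * den q + neg q * den r) + c * (den q * den r).
Definition diff_le V (q r c n : tm V tO) : fm V :=
  exp2 n * (pos q * den r + neg r * den q) ≼
  exp2 n * (pos r * den q + neg q * den r) + c * (den q * den r).
Definition diff_gt V (q r c n : tm V tO) : fm V :=
  exp2 n * (pos r * den q + neg q * den r) + c * (den q * den r) ≺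
  exp2 n * (pos q * den r + neg r * den q).

(* |x_n - x_{n+i}| < 2^-n, with n = #1 and i = #0 *)
Definition real V (x : tm V t1) : fm V :=
  ∀[tO] ∀[tO] diff_lt (x↑↑ · #1) (x↑↑ · (#1 + #0)) 1 #1 ∧
              diff_lt (x↑↑ · (#1 + #0)) (x↑↑ · #1) 1 #1.

(* |x_n - y_n| <= 2^(-n+1) *)
Definition eqR V (x y : tm V t1) : fm V :=
  ∀[tO] diff_le (x↑ · #0) (y↑ · #0) (num 2) #0 ∧
        diff_le (y↑ · #0) (x↑ · #0) (num 2) #0.

(* y_n - x_n > 2^(-n+1) for some n *)
Definition ltR V (x y : tm V t1) : fm V :=
  ∃[tO] diff_gt (y↑ · #0) (x↑ · #0) (num 2) #0.

Definition leR V (x y : tm V t1) : fm V := ¬ ltR y x.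

Definition zeroR V : tm V t1 := lam (pairN 0 0).
Definition oneR V : tm V t1 := lam (pairN (num 2) 0).
Arguments zeroR {V}.
Arguments oneR {V}.

Definition in01 V (x : tm V t1) : fm V := real x ∧ leR zeroR x ∧ leR x oneR.

(* Functions on reals are functionals on representations that respect [eqR]:
   F : R -> R,  F : R x R -> R,  Y : R -> N,  Y : [0,1] -> N. *)
Definition funRR V (F : tm V (t1 ⇾ t1)) : fm V :=
  (∀[t1] real #0 ⟶ real (F↑ · #0)) ∧
  (∀[t1] ∀[t1] real #1 ⟶ real #0 ⟶ eqR #1 #0 ⟶
     eqR (F↑↑ · #1) (F↑↑ · #0)).
Definition funRRR V (F : tm V (t1 ⇾ t1 ⇾ t1)) : fm V :=
  (∀[t1] ∀[t1] real #1 ⟶ real #0 ⟶ real (F↑↑ · #1 · #0)) ∧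
  (∀[t1] ∀[t1] ∀[t1] real #2 ⟶ real #1 ⟶ real #0 ⟶ eqR #2 #1 ⟶
     eqR (F↑↑↑ · #2 · #0) (F↑↑↑ · #1 · #0) ∧
     eqR (F↑↑↑ · #0 · #2) (F↑↑↑ · #0 · #1)).
Definition funRN V (Y : tm V t2) : fm V :=
  ∀[t1] ∀[t1] real #1 ⟶ real #0 ⟶ eqR #1 #0 ⟶ Y↑↑ · #1 ≐ Y↑↑ · #0.
Definition fun01N V (Y : tm V t2) : fm V :=
  ∀[t1] ∀[t1] in01 #1 ⟶ in01 #0 ⟶ eqR #1 #0 ⟶ Y↑↑ · #1 ≐ Y↑↑ · #0.

(* A set of reals is a function A : R -> R, with x in A iff A(x) > 0;
   a binary relation R on the reals is a function of two arguments, with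
   x R y iff R(x,y) > 0. *)
Definition mem V (x : tm V t1) (A : tm V (t1 ⇾ t1)) : fm V :=
  real x ∧ ltR zeroR (A · x).
Definition related V (R : tm V (t1 ⇾ t1 ⇾ t1)) (x y : tm V t1) : fm V :=
  ltR zeroR (R · x · y).

Definition injective_on V (Y : tm V t2) (A : tm V (t1 ⇾ t1)) : fm V :=
  ∀[t1] ∀[t1] mem #1 A↑↑ ⟶ mem #0 A↑↑ ⟶ Y↑↑ · #1 ≐ Y↑↑ · #0 ⟶ eqR #1 #0.
Definition onto_from V (Y : tm V t2) (A : tm V (t1 ⇾ t1)) : fm V :=
  ∀[tO] ∃[t1] mem #0 A↑↑ ∧ Y↑↑ · #0 ≐ #1.
Definition strongly_countable V (A : tm V (t1 ⇾ t1)) : fm V :=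
  ∃[t2] funRN #0 ∧ injective_on #0 A↑ ∧ onto_from #0 A↑.

(* values in {0,...,k}, with k = #1 and Y = #0 *)
Definition finite V (A : tm V (t1 ⇾ t1)) : fm V :=
  ∃[tO] ∃[t2] funRN #0 ∧ injective_on #0 A↑↑ ∧
    (∀[t1] mem #0 A↑↑↑ ⟶ #1 · #0 ≼ #2).
Definition infinite V (A : tm V (t1 ⇾ t1)) : fm V := ¬ finite A.
Definition nonempty V (A : tm V (t1 ⇾ t1)) : fm V := ∃[t1] mem #0 A↑.

Definition symmetric V (R : tm V (t1 ⇾ t1 ⇾ t1)) : fm V :=
  ∀[t1] ∀[t1] real #1 ⟶ real #0 ⟶ related R↑↑ #1 #0 ⟶ related R↑↑ #0 #1.

(* E_n, n >= 1, are non-empty finite sets with union G *)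
Definition finite_exhaustion V (G : tm V (t1 ⇾ t1)) (E : tm V (tO ⇾ t1 ⇾ t1)) :
  fm V :=
  (∀[tO] 1 ≼ #0 ⟶
     funRR (E↑ · #0) ∧ nonempty (E↑ · #0) ∧ finite (E↑ · #0)) ∧
  (∀[t1] mem #0 G↑ ⟷ ∃[tO] 1 ≼ #0 ∧ mem #1 (E↑↑ · #0)).

(* every x in E_{n+1} is related to some y in E_n; n = #2, x = #1, y = #0 *)
Definition linked V (R : tm V (t1 ⇾ t1 ⇾ t1)) (E : tm V (tO ⇾ t1 ⇾ t1)) :
  fm V :=
  ∀[tO] 1 ≼ #0 ⟶ ∀[t1] mem #0 (E↑↑ · (#1 + 1)) ⟶
    ∃[t1] mem #0 (E↑↑↑ · #2) ∧ related R↑↑↑ #1 #0.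

Definition infinite_path V (R : tm V (t1 ⇾ t1 ⇾ t1))
  (E : tm V (tO ⇾ t1 ⇾ t1)) : fm V :=
  ∃[tO ⇾ t1] ∀[tO] 1 ≼ #0 ⟶
    mem (#1 · #0) (E↑↑ · #0) ∧ related R↑↑ (#1 · #0) (#1 · (#0 + 1)).

(* G = #2, R = #1, E = #0 *)
Definition Korg1 : fm noVar :=
  ∀[t1 ⇾ t1] ∀[t1 ⇾ t1 ⇾ t1] ∀[tO ⇾ t1 ⇾ t1]
    funRR #2 ∧ infinite #2 ∧ strongly_countable #2 ∧
    funRRR #1 ∧ symmetric #1 ∧
    finite_exhaustion #2 #0 ∧ linked #1 #0 ⟶
    infinite_path #1 #0.

Definition NBI : fm noVar :=
  ∀[t2] fun01N #0 ⟶
    (∃[t1] ∃[t1] in01 #1 ∧ in01 #0 ∧ ¬ eqR #1 #0 ∧ #2 · #1 ≐ #2 · #0) ∨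
    (∃[tO] ∀[t1] in01 #0 ⟶ ¬ (#2 · #0 ≐ #1)).

(* Main.v *)
(* By completeness it suffices to show that every extensional model of RCA_0^omega satisfying
   Korg_1 satisfies NBI.  The completeness theorem is Henkin's: a consistent theory extends to a
   maximal one with witnesses, and its terms modulo provable equality form a model.  The numbers
   of a model are an ordered semiring and embed in an ordered field K, in which all computations
   with (approximations of) reals take place.

   In a model, let Y : [0,1] -> N be a bijection.  Since Y is injective it decides equality with
   0: let c(x) be the projection of x to [0,1] and d(x) the distance of x from [0,1]; then x is
   in [0,1] iff Y(c(d(x))) = Y(0).  Hence G = [0,1] is a set, as is E_n = {x in G : Y(x) + 1 = n},
   and G is strongly countable by Y.  With the total relation as R, Korg_1 yields a sequence that
   enumerates [0,1], which is refuted by diagonalization. *)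

From HB Require Import structures.
From mathcomp Require Import all_boot all_order all_algebra.
From mathcomp Require Import boolp.
From mathcomp Require ring lra.
From Stdlib Require Import Ring.
From Stdlib Require List Eqdep_dec.
Require Import Defs.

Set Implicit Arguments.
Unset Strict Implicit.
Unset Printing Implicit Defensive.
Unset Asymmetric Patterns.

Import Order.TTheory GRing.Theory Num.Theory.
Local Open Scope fm_scope.

(** * Substitution *)

(** Passing to a model replaces formal derivations by ordinary mathematics, under three
    restrictions. The numbers of the model may be nonstandard, so counting has to be internal.
    Induction covers only quantifier-free predicates and recursion only maps from numbers to
    numbers, so auxiliary facts are put as equations and inequalities between terms. Whatever is
    passed to Korg_1 must be an element of the model, hence the value of a term with parameters.

    [Y] respects equality only on [0,1], whereas a set is a function on all reals. This is why [Y]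
    is always composed with the projection c, even after the distance d, which may exceed 1. The
    sets E_n are singletons, so a path has no freedom: its member in E_{n+1} is the point with
    [Y]-value n.

    The order of reals is not decidable by a term, so the diagonal chooses its digits by comparing
    one rational approximation with a midpoint. In base 4 the digits 0 and 3 leave a margin that
    absorbs the error of the approximation. *)

Definition idsub V : sub V V := fun _ v => Var v.
Arguments idsub {V}.

Definition subst_closed (T : forall V, fm V -> Prop) :=
  forall V W (r : sub V W) (φ : fm V), T V φ -> T W (fsub r φ).

Lemma ext_funext V σ (A : ty -> Type) (f g : forall τ, ext V σ τ -> A τ) :
  f σ new = g σ new -> (forall τ (v : V τ), f τ (old v) = g τ (old v)) -> f = g.
Proof.
move=> fgn fgo; apply: functional_extensionality_dep => τ.
by apply: functional_extensionality_dep => -[|? v]; auto.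
Qed.

Lemma tren_tsub V W (r : ren V W) τ (s : tm V τ) :
  tren r s = tsub (fun _ v => Var (r _ v)) s.
Proof. by elim: s => //= σ {}τ f -> s ->. Qed.

Lemma slift_ren V W σ (r : ren V W) :
  slift (σ := σ) (fun _ v => Var (r _ v)) = fun _ v => Var (rlift r v).
Proof. exact: ext_funext. Qed.

Lemma fren_fsub V W (r : ren V W) (φ : fm V) :
  fren r φ = fsub (fun _ v => Var (r _ v)) φ.
Proof.
elim: φ W r => [V' s t|V' s t|V'|V' φ IH1 ψ IH2|V' φ IH1 ψ IH2|V' φ IH1 ψ IH2
  |V' σ φ IH|V' σ φ IH] W r //=; rewrite ?tren_tsub ?IH1 ?IH2 //.
- by rewrite IH slift_ren.
- by rewrite IH slift_ren.
Qed.

Lemma tsub_tsub U V W (r : sub U V) (q : sub V W) τ (s : tm U τ) :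
  tsub q (tsub r s) = tsub (fun _ v => tsub q (r _ v)) s.
Proof. by elim: s => //= σ {}τ f -> s ->. Qed.

Lemma tsub_ext V W (r q : sub V W) τ (s : tm V τ) :
  (forall τ v, r τ v = q τ v) -> tsub r s = tsub q s.
Proof. by move=> rq; elim: s => //= σ {}τ f -> s ->. Qed.

Lemma tsub_twk V W σ (r : sub V W) τ (s : tm V τ) :
  tsub (slift (σ := σ) r) (twk σ s) = twk σ (tsub r s).
Proof.
by rewrite /twk !tren_tsub !tsub_tsub; apply: tsub_ext => *; rewrite -tren_tsub.
Qed.

Lemma tsub_scons_twk V W σ (t : tm W σ) (r : sub V W) τ (s : tm V τ) :
  tsub (scons t r) (twk σ s) = tsub r s.
Proof. by rewrite /twk tren_tsub tsub_tsub. Qed.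

Lemma fsub_fsub U V W (r : sub U V) (q : sub V W) (φ : fm U) :
  fsub q (fsub r φ) = fsub (fun _ v => tsub q (r _ v)) φ.
Proof.
have liftE U' V' W' σ (r' : sub U' V') (q' : sub V' W') :
    (fun _ v => tsub (slift (σ := σ) q') (slift r' v)) =
    slift (fun _ v => tsub q' (r' _ v)).
  by apply: ext_funext => //= τ v; rewrite tsub_twk.
elim: φ V W r q => [U' s t|U' s t|U'|U' φ IH1 ψ IH2|U' φ IH1 ψ IH2|U' φ IH1 ψ IH2
  |U' σ φ IH|U' σ φ IH] V W r q //=; rewrite ?tsub_tsub ?IH1 ?IH2 //.
- by rewrite IH liftE.
- by rewrite IH liftE.
Qed.

Lemma tsub_id V τ (s : tm V τ) : tsub idsub s = s.
Proof. by elim: s => //= σ {}τ f -> s ->. Qed.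

Lemma slift_id V σ : slift (σ := σ) (@idsub V) = idsub.
Proof. exact: ext_funext. Qed.

Lemma fsub_id V (φ : fm V) : fsub idsub φ = φ.
Proof.
elim: φ => [? s t|? s t|?|? φ IH1 ψ IH2|? φ IH1 ψ IH2|? φ IH1 ψ IH2
  |? σ φ IH|? σ φ IH] //=; rewrite ?tsub_id ?IH1 ?IH2 //.
- by rewrite slift_id IH.
- by rewrite slift_id IH.
Qed.

Lemma fsub_fwk V W σ (r : sub V W) (φ : fm V) :
  fsub (slift (σ := σ) r) (fwk σ φ) = fwk σ (fsub r φ).
Proof.
rewrite /fwk !fren_fsub !fsub_fsub; congr (fsub _ _).
apply: functional_extensionality_dep => τ; apply: functional_extensionality_dep => v.
by rewrite -tren_tsub.
Qed.

Lemma fsub_inst V W σ (r : sub V W) (s : tm V σ) (φ : fm (ext V σ)) :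
  fsub r (inst s φ) = inst (tsub r s) (fsub (slift r) φ).
Proof.
rewrite /inst !fsub_fsub; congr (fsub _ _); apply: ext_funext => //= τ v.
by rewrite tsub_scons_twk tsub_id.
Qed.

Lemma inst_slift V W σ (r : sub V W) (s : tm W σ) (φ : fm (ext V σ)) :
  inst s (fsub (slift r) φ) = fsub (scons s r) φ.
Proof.
rewrite /inst fsub_fsub; congr (fsub _ _); apply: ext_funext => //= τ v.
by rewrite tsub_scons_twk tsub_id.
Qed.

Lemma tsub_EqT V W (r : sub V W) τ (s t : tm V τ) :
  fsub r (EqT s t) = EqT (tsub r s) (tsub r t).
Proof. by elim: τ V W r s t => //= σ _ τ IH V W r s t; rewrite IH /= !tsub_twk. Qed.

Lemma prv_weaken T V (Γ Δ : list (fm V)) (φ : fm V) :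
  prv T Γ φ -> (forall ψ, List.In ψ Γ -> List.In ψ Δ) -> prv T Δ φ.
Proof.
move=> p; elim: p Δ => {V Γ φ}.
- by move=> V Γ φ Tφ Δ _; exact: prvT.
- by move=> V Γ φ Γφ Δ sΓ; apply/prvHyp/sΓ.
- move=> V Γ φ ψ _ IH Δ sΓ; apply: prvII; apply: IH => χ [->|/sΓ]; by [left|right].
- by move=> V Γ φ ψ _ IH1 _ IH2 Δ sΓ; apply: prvIE (IH1 _ sΓ) (IH2 _ sΓ).
- by move=> V Γ φ ψ _ IH1 _ IH2 Δ sΓ; apply: prvAI (IH1 _ sΓ) (IH2 _ sΓ).
- by move=> V Γ φ ψ _ IH Δ sΓ; apply: prvAE1 (IH _ sΓ).
- by move=> V Γ φ ψ _ IH Δ sΓ; apply: prvAE2 (IH _ sΓ).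
- by move=> V Γ φ ψ _ IH Δ sΓ; apply: prvOI1 (IH _ sΓ).
- by move=> V Γ φ ψ _ IH Δ sΓ; apply: prvOI2 (IH _ sΓ).
- move=> V Γ φ ψ χ _ IH _ IH1 _ IH2 Δ sΓ; apply: prvOE (IH _ sΓ) (IH1 _ _) (IH2 _ _).
  + by move=> ? [->|/sΓ]; [left|right].
  + by move=> ? [->|/sΓ]; [left|right].
- move=> V Γ φ _ IH Δ sΓ; apply: prvRAA; apply: IH => ? [->|/sΓ]; by [left|right].
- move=> V Γ σ φ _ IH Δ sΓ; apply: prvUI; apply: IH => ?.
  by move=> /List.in_map_iff [ψ [<- /sΓ Δψ]]; apply: List.in_map.
- by move=> V Γ σ φ s _ IH Δ sΓ; apply: prvUE (IH _ sΓ).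
- by move=> V Γ σ φ s _ IH Δ sΓ; apply: prvEI (IH _ sΓ).
- move=> V Γ σ φ ψ _ IH1 _ IH2 Δ sΓ; apply: prvEE (IH1 _ sΓ) (IH2 _ _) => ? [->|].
    by left.
  by move=> /List.in_map_iff [χ [<- /sΓ Δχ]]; right; apply: List.in_map.
Qed.

Lemma map_slift_fwk V W σ (r : sub V W) (Γ : list (fm V)) :
  List.map (fsub (slift (σ := σ) r)) (List.map (fwk σ) Γ) =
  List.map (fwk σ) (List.map (fsub r) Γ).
Proof. by rewrite !List.map_map; apply: List.map_ext => φ; rewrite fsub_fwk. Qed.

Lemma prv_fsub T V W (r : sub V W) (Γ : list (fm V)) (φ : fm V) :
  subst_closed T -> prv T Γ φ -> prv T (List.map (fsub r) Γ) (fsub r φ).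
Proof.
move=> Tr p; elim: p W r => {V Γ φ}.
- by move=> V Γ φ Tφ W r; exact/prvT/Tr.
- by move=> V Γ φ Γφ W r; apply/prvHyp/List.in_map.
- by move=> V Γ φ ψ _ IH W r; apply/prvII/IH.
- by move=> V Γ φ ψ _ IH1 _ IH2 W r; apply: prvIE (IH1 _ r) (IH2 _ r).
- by move=> V Γ φ ψ _ IH1 _ IH2 W r; apply: prvAI (IH1 _ r) (IH2 _ r).
- by move=> V Γ φ ψ _ IH W r; apply: prvAE1 (IH _ r).
- by move=> V Γ φ ψ _ IH W r; apply: prvAE2 (IH _ r).
- by move=> V Γ φ ψ _ IH W r; apply: prvOI1 (IH _ r).
- by move=> V Γ φ ψ _ IH W r; apply: prvOI2 (IH _ r).
- by move=> V Γ φ ψ χ _ IH _ IH1 _ IH2 W r; apply: prvOE (IH _ r) (IH1 _ r) (IH2 _ r).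
- by move=> V Γ φ _ IH W r; apply/prvRAA/IH.
- by move=> V Γ σ φ _ IH W r; apply: prvUI; rewrite -map_slift_fwk; apply: IH.
- by move=> V Γ σ φ s _ IH W r; rewrite fsub_inst; apply: prvUE; apply: (IH _ r).
- move=> V Γ σ φ s _ IH W r /=; apply: (prvEI (s := tsub r s)).
  by rewrite -fsub_inst; apply: IH.
- move=> V Γ σ φ ψ _ IH1 _ IH2 W r; apply: prvEE (IH1 _ r) _.
  by rewrite -map_slift_fwk -fsub_fwk; apply: IH2.
Qed.

Lemma fsub_instS V W (r : sub V W) (φ : fm (ext V tO)) :
  fsub (slift r) (instS φ) = instS (fsub (slift r) φ).
Proof.
rewrite /instS !fsub_fsub; congr (fsub _ _); apply: ext_funext => //= τ v.
by rewrite /twk !tren_tsub !tsub_tsub; apply: tsub_ext.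
Qed.

Lemma fsub_instY V W (r : sub V W) (φ : fm (ext (ext V t1) tO)) :
  fsub (slift (slift r)) (instY φ) = instY (fsub (slift (slift r)) φ).
Proof.
rewrite /instY !fsub_fsub; congr (fsub _ _).
apply: ext_funext => //= τ; case=> //= {}τ v.
by rewrite /twk !tren_tsub !tsub_tsub; apply: tsub_ext.
Qed.

Lemma qf_fsub V W (r : sub V W) (φ : fm V) : qf φ -> qf (fsub r φ).
Proof.
by elim: φ W r => //= V' φ IH1 ψ IH2 W r [/IH1 h1 /IH2 h2].
Qed.

Lemma RCA0w_subst : subst_closed (@RCA0w).
Proof.
move=> V W r φ; case=> *; rewrite /= ?tsub_EqT ?fsub_inst ?fsub_instS ?fsub_instY /=;
  by constructor => //; apply: qf_fsub.
Qed.

(** * Henkin extensions *)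

(** The support predicates express freshness: a substitution matters only on the variables that
    occur, and a variable outside the support can serve as a Henkin witness. *)
Fixpoint tsupp (V : ty -> Set) (P : forall τ, V τ -> Prop) τ (s : tm V τ) : Prop :=
  match s with
  | Var v => P _ v
  | Cst _ => True
  | App f s => tsupp P f /\ tsupp P s
  end.

Definition psucc (V : ty -> Set) σ (P : forall τ, V τ -> Prop) : forall τ, ext V σ τ -> Prop :=
  fun _ v => match v with new => True | old v => P _ v end.

Fixpoint fsupp (V : ty -> Set) (P : forall τ, V τ -> Prop) (φ : fm V) : Prop :=
  match φ with
  | Eq s t => tsupp P s /\ tsupp P t
  | Lt s t => tsupp P s /\ tsupp P t
  | Bot => True
  | Imp φ ψ => fsupp P φ /\ fsupp P ψ
  | And φ ψ => fsupp P φ /\ fsupp P ψ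
  | Or φ ψ => fsupp P φ /\ fsupp P ψ
  | All σ φ => fsupp (psucc P) φ
  | Ex σ φ => fsupp (psucc P) φ
  end.

Lemma tsub_agree (V W : ty -> Set) (P : forall τ, V τ -> Prop) (r q : sub V W) τ (s : tm V τ) :
  (forall τ v, P τ v -> r τ v = q τ v) -> tsupp P s -> tsub r s = tsub q s.
Proof.
move=> rq; elim: s => //= σ {}τ f IHf s IHs [Pf Ps].
by rewrite IHf ?IHs.
Qed.

Lemma fsub_agree (V W : ty -> Set) (P : forall τ, V τ -> Prop) (r q : sub V W) (φ : fm V) :
  (forall τ v, P τ v -> r τ v = q τ v) -> fsupp P φ -> fsub r φ = fsub q φ.
Proof.
elim: φ W P r q => [V' s t|V' s t|V'|V' φ IH1 ψ IH2|V' φ IH1 ψ IH2|V' φ IH1 ψ IH2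
  |V' σ φ IH|V' σ φ IH] W P r q rq //=.
- by case=> Ps Pt; rewrite (tsub_agree rq Ps) (tsub_agree rq Pt).
- by case=> Ps Pt; rewrite (tsub_agree rq Ps) (tsub_agree rq Pt).
- by case=> P1 P2; rewrite (IH1 _ _ _ _ rq P1) (IH2 _ _ _ _ rq P2).
- by case=> P1 P2; rewrite (IH1 _ _ _ _ rq P1) (IH2 _ _ _ _ rq P2).
- by case=> P1 P2; rewrite (IH1 _ _ _ _ rq P1) (IH2 _ _ _ _ rq P2).
- by move=> Pφ; congr (All _ _); apply: IH Pφ => τ [//|{}τ v /= /rq ->].
- by move=> Pφ; congr (Ex _ _); apply: IH Pφ => τ [//|{}τ v /= /rq ->].
Qed.

Lemma tsupp_mono (V : ty -> Set) (P Q : forall τ, V τ -> Prop) τ (s : tm V τ) :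
  (forall τ v, P τ v -> Q τ v) -> tsupp P s -> tsupp Q s.
Proof. by move=> PQ; elim: s => /= [? ? /PQ|//|? ? f IHf s IHs [/IHf ? /IHs ?]]. Qed.

Lemma fsupp_mono (V : ty -> Set) (P Q : forall τ, V τ -> Prop) (φ : fm V) :
  (forall τ v, P τ v -> Q τ v) -> fsupp P φ -> fsupp Q φ.
Proof.
elim: φ P Q => [V' s t|V' s t|V'|V' φ IH1 ψ IH2|V' φ IH1 ψ IH2|V' φ IH1 ψ IH2
  |V' σ φ IH|V' σ φ IH] P Q PQ //=.
- by case=> /(tsupp_mono PQ) ? /(tsupp_mono PQ) ?.
- by case=> /(tsupp_mono PQ) ? /(tsupp_mono PQ) ?.
- by case=> /(IH1 _ _ PQ) ? /(IH2 _ _ PQ) ?.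
- by case=> /(IH1 _ _ PQ) ? /(IH2 _ _ PQ) ?.
- by case=> /(IH1 _ _ PQ) ? /(IH2 _ _ PQ) ?.
- by apply: IH => τ [//|? v /= /PQ].
- by apply: IH => τ [//|? v /= /PQ].
Qed.

Definition below (V : ty -> Set) (m : forall τ, V τ -> nat) (k : nat) : forall τ, V τ -> Prop :=
  fun τ v => is_true (m τ v < k)%N.

Lemma below_mono (V : ty -> Set) (m : forall τ, V τ -> nat) (k l : nat) :
  (k <= l)%N -> forall τ v, below m k (τ := τ) v -> below m l v.
Proof. by move=> kl τ v; rewrite /below => /leq_trans; apply. Qed.

Lemma tsupp_below (V : ty -> Set) (m : forall τ, V τ -> nat) τ (s : tm V τ) :
  exists k, tsupp (below m k) s.
Proof.
elim: s => [{}τ v|{}τ c|σ {}τ f [k fk] s [l sl]].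
- by exists (m _ v).+1; rewrite /= /below.
- by exists 0%N.
- exists (maxn k l); split; [move: fk|move: sl]; apply/tsupp_mono/below_mono.
    exact: leq_maxl.
  exact: leq_maxr.
Qed.

Lemma fsupp_below (V : ty -> Set) (m : forall τ, V τ -> nat) (φ : fm V) :
  exists k, fsupp (below m k) φ.
Proof.
have join (V' : ty -> Set) (m' : forall τ, V' τ -> nat) (A B : (forall τ, V' τ -> Prop) -> Prop) :
    (forall P Q, (forall τ v, P τ v -> Q τ v) -> A P -> A Q) ->
    (forall P Q, (forall τ v, P τ v -> Q τ v) -> B P -> B Q) ->
    (exists k, A (below m' k)) -> (exists k, B (below m' k)) ->
    exists k, A (below m' k) /\ B (below m' k).
  move=> Am Bm [k Ak] [l Bl]; exists (maxn k l).
  by split; [apply: Am Ak|apply: Bm Bl]; apply: below_mono; rewrite ?leq_maxl ?leq_maxr.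
have binder (V' : ty -> Set) σ (m' : forall τ, V' τ -> nat) (ψ : fm (ext V' σ)) :
    (forall m, exists k, fsupp (below m k) ψ) ->
    exists k, fsupp (psucc (below m' k)) ψ.
  (* The number given to the bound variable is immaterial, since [psucc] accepts it in any case. *)
  move=> /(_ (fun τ v => match v with new => 0%N | old v => m' _ v end)) [k ψk].
  by exists k; apply: fsupp_mono ψk => τ [].
elim: φ m => [V' s t|V' s t|V'|V' φ IH1 ψ IH2|V' φ IH1 ψ IH2|V' φ IH1 ψ IH2
  |V' σ φ IH|V' σ φ IH] m /=.
- by apply: (join _ m (fun P => tsupp P s) (fun P => tsupp P t));
    by [exact: tsupp_below | move=> P Q; exact: tsupp_mono].
- by apply: (join _ m (fun P => tsupp P s) (fun P => tsupp P t));
    by [exact: tsupp_below | move=> P Q; exact: tsupp_mono].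
- by exists 0%N.
- by apply: (join _ m (fun P => fsupp P φ) (fun P => fsupp P ψ));
    by [exact: IH1 | exact: IH2 | move=> P Q; exact: fsupp_mono].
- by apply: (join _ m (fun P => fsupp P φ) (fun P => fsupp P ψ));
    by [exact: IH1 | exact: IH2 | move=> P Q; exact: fsupp_mono].
- by apply: (join _ m (fun P => fsupp P φ) (fun P => fsupp P ψ));
    by [exact: IH1 | exact: IH2 | move=> P Q; exact: fsupp_mono].
- exact: binder.
- exact: binder.
Qed.

(** Infinitely many variables of each type: no finite list of formulas uses them all, so free
    variables serve as Henkin constants and the language need not be extended. *)
Definition natVar : ty -> Set := fun _ => nat.

Lemma fsupp_below_list (Γ : list (fm natVar)) :
  exists k, forall φ, List.In φ Γ -> fsupp (below (V := natVar) (fun _ n => n) k) φ.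
Proof.
elim: Γ => [|φ Γ [k Γk]]; first by exists 0%N.
have [l φl] := fsupp_below (V := natVar) (fun _ n => n) φ.
exists (maxn k l) => ψ [<-|/Γk ψk].
  by apply: fsupp_mono φl; apply: below_mono; rewrite leq_maxr.
by apply: fsupp_mono ψk; apply: below_mono; rewrite leq_maxl.
Qed.

Lemma ty_eq_dec (σ τ : ty) : {σ = τ} + {σ <> τ}.
Proof. by decide equality. Qed.

(* Renames the variable [k] of type [σ] to [new]. *)
Definition unname σ (k : nat) : sub natVar (ext natVar σ) :=
  fun τ n =>
    match ty_eq_dec σ τ with
    | left e => if n == k then Var (eq_rect σ (ext natVar σ) new τ e) else Var (old n)
    | right _ => Var (old n)
    end.

Lemma unname_new σ k : unname σ k (τ := σ) k = Var new.
Proof.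
rewrite /unname; case: ty_eq_dec => // e; rewrite eqxx.
by rewrite (Eqdep_dec.UIP_dec ty_eq_dec e erefl).
Qed.

Lemma unname_old σ k τ (n : natVar τ) : (n < k)%N -> unname σ k n = Var (old n).
Proof. by rewrite /unname; case: ty_eq_dec => // e nk; rewrite ltn_eqF. Qed.

(** The witness is a variable [k] beyond all those of [Γ]. Turning it into the newest variable makes
    a refutation of [inst (Var k) φ :: Γ] the second premise of existential elimination, because [Γ]
    is then merely weakened. *)
Lemma prv_witness T (Γ : list (fm natVar)) σ (φ : fm (ext natVar σ)) :
  subst_closed T -> List.In (Ex σ φ) Γ ->
  exists t, prv T (inst t φ :: Γ) ⊥ -> prv T Γ ⊥.
Proof.
move=> Tr Γφ; have [k Γk] := fsupp_below_list Γ; exists (Var k) => p.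
apply: (prvEE (prvHyp _ Γφ)); change (fwk σ ⊥) with (fsub (unname σ k) ⊥).
have -> : φ :: List.map (fwk σ) Γ = List.map (fsub (unname σ k)) (inst (Var k) φ :: Γ).
  congr cons.
    rewrite /inst fsub_fsub -[LHS]fsub_id.
    have /= φk := Γk _ Γφ.
    apply: fsub_agree φk => τ [_|{}τ v] /=; first by rewrite unname_new.
    by move=> vk; rewrite unname_old.
  apply: List.map_ext_in => ψ /Γk ψk; rewrite /fwk fren_fsub.
  by apply: fsub_agree ψk => τ v vk; rewrite unname_old.
exact: prv_fsub.
Qed.

(** * Countability of the set of formulas *)

Notation code := (GenTree.tree nat).
Notation node := (@GenTree.Node nat).
Notation leaf := (@GenTree.Leaf nat).

Fixpoint ty_code (τ : ty) : code :=
  match τ with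
  | tO => leaf 0
  | Arr σ τ => node 0 [:: ty_code σ; ty_code τ]
  end.

Lemma ty_code_inj : injective ty_code.
Proof. by elim=> [|σ IH1 τ IH2] [|σ' τ'] //= [/IH1 -> /IH2 ->]. Qed.

Definition cst_code τ (c : cst τ) : code :=
  match c with
  | c0 => leaf 0
  | c1 => leaf 1
  | cAdd => leaf 2
  | cMul => leaf 3
  | cK σ τ => node 0 [:: ty_code σ; ty_code τ]
  | cS ρ σ τ => node 1 [:: ty_code ρ; ty_code σ; ty_code τ]
  | cRec => leaf 4
  end.

Lemma cst_code_inj σ (c : cst σ) τ (d : cst τ) :
  cst_code c = cst_code d -> existT cst σ c = existT cst τ d.
Proof.
case: c => [||||σ1 σ2|σ1 σ2 σ3|]; case: d => [||||τ1 τ2|τ1 τ2 τ3|] //=.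
  by case=> /ty_code_inj <- /ty_code_inj <-.
by case=> /ty_code_inj <- /ty_code_inj <- /ty_code_inj <-.
Qed.

(** Injectivity is stated for dependent pairs because a code must determine the type as well: an
    application hides the type of its argument. *)
Definition var_code_inj (V : ty -> Set) (m : forall τ, V τ -> code) :=
  forall σ (v : V σ) τ (w : V τ), m σ v = m τ w -> existT V σ v = existT V τ w.

Fixpoint tm_code (V : ty -> Set) (m : forall τ, V τ -> code) τ (s : tm V τ) : code :=
  match s with
  | Var v => node 0 [:: m _ v]
  | Cst c => node 1 [:: cst_code c]
  | App f s => node 2 [:: tm_code m f; tm_code m s]
  end.

Lemma existT_inj (A : ty -> Type) τ (a b : A τ) : existT A τ a = existT A τ b -> a = b.
Proof. exact: Eqdep_dec.inj_pair2_eq_dec ty_eq_dec _ _ _ _. Qed.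

Lemma existT_App (V : ty -> Set) ρ σ (f : tm V (ρ ⇾ σ)) (s : tm V ρ)
    ρ' σ' (g : tm V (ρ' ⇾ σ')) (t : tm V ρ') :
  existT (tm V) _ f = existT (tm V) _ g -> existT (tm V) _ s = existT (tm V) _ t ->
  existT (tm V) _ (App f s) = existT (tm V) _ (App g t).
Proof.
move=> fg; case: (projT1_eq fg) => /= eρ eσ; case: _ / eρ g t fg => g t; case: _ / eσ g => g.
by move=> /(@existT_inj (tm V)) -> /(@existT_inj (tm V)) ->.
Qed.

Lemma tm_code_inj (V : ty -> Set) (m : forall τ, V τ -> code) σ (s : tm V σ) τ (t : tm V τ) :
  var_code_inj m -> tm_code m s = tm_code m t -> existT (tm V) σ s = existT (tm V) τ t.
Proof.
move=> mi; elim: s τ t => [σ' v|σ' c|ρ σ' f IHf s IHs] τ [τ' w|τ' d|ρ' τ' g t] //= [].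
- by move=> /mi /(congr1 (fun p => existT (tm V) (projT1 p) (Var (projT2 p)))).
- by move=> /cst_code_inj /(congr1 (fun p => existT (tm V) (projT1 p) (Cst (projT2 p)))).
- by move=> /IHf fg /IHs st; apply: existT_App.
Qed.

Definition ext_code (V : ty -> Set) σ (m : forall τ, V τ -> code) : forall τ, ext V σ τ -> code :=
  fun _ v => match v with new => leaf 0 | old v => node 0 [:: m _ v] end.

Lemma ext_code_inj (V : ty -> Set) σ (m : forall τ, V τ -> code) :
  var_code_inj m -> var_code_inj (ext_code (σ := σ) m).
Proof.
move=> mi τ [|{}τ v] ρ [|{}ρ w] //= [] /mi.
by move=> /(congr1 (fun p => existT (ext V σ) (projT1 p) (old (projT2 p)))).
Qed.

Fixpoint fm_code (V : ty -> Set) (m : forall τ, V τ -> code) (φ : fm V) : code :=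
  match φ with
  | Eq s t => node 0 [:: tm_code m s; tm_code m t]
  | Lt s t => node 1 [:: tm_code m s; tm_code m t]
  | Bot => leaf 0
  | Imp φ ψ => node 2 [:: fm_code m φ; fm_code m ψ]
  | And φ ψ => node 3 [:: fm_code m φ; fm_code m ψ]
  | Or φ ψ => node 4 [:: fm_code m φ; fm_code m ψ]
  | All σ φ => node 5 [:: ty_code σ; fm_code (ext_code m) φ]
  | Ex σ φ => node 6 [:: ty_code σ; fm_code (ext_code m) φ]
  end.

Lemma fm_code_inj (V : ty -> Set) (m : forall τ, V τ -> code) :
  var_code_inj m -> injective (fm_code m).
Proof.
move=> mi φ; elim: φ m mi => [V' s t|V' s t|V'|V' φ IH1 ψ IH2|V' φ IH1 ψ IH2
  |V' φ IH1 ψ IH2|V' σ φ IH|V' σ φ IH] m mi [s' t'|s' t'||φ' ψ'|φ' ψ'|φ' ψ'|σ' φ'|σ' φ'] //= [].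
- by move=> /(tm_code_inj mi) /(@existT_inj (tm V')) -> /(tm_code_inj mi) /(@existT_inj (tm V')) ->.
- by move=> /(tm_code_inj mi) /(@existT_inj (tm V')) -> /(tm_code_inj mi) /(@existT_inj (tm V')) ->.
- by move=> /(IH1 _ mi) -> /(IH2 _ mi) ->.
- by move=> /(IH1 _ mi) -> /(IH2 _ mi) ->.
- by move=> /(IH1 _ mi) -> /(IH2 _ mi) ->.
- by move=> /ty_code_inj e; case: _ / e φ' => φ' /(IH _ (ext_code_inj mi)) ->.
- by move=> /ty_code_inj e; case: _ / e φ' => φ' /(IH _ (ext_code_inj mi)) ->.
Qed.

Lemma fm_enum : exists e : nat -> fm natVar, forall φ, exists n, e n = φ.
Proof.
pose m τ (n : natVar τ) : code := node n [:: ty_code τ].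
have mi : var_code_inj m.
  by move=> σ v τ w [e /ty_code_inj eτ]; move: v w e; rewrite eτ => v w ->.
pose num φ := pickle (fm_code m φ).
(* Numbers that code no formula are sent to [⊥]. *)
exists (fun n => if pselect (exists φ, num φ = n) is left ex then projT1 (cid ex) else ⊥).
move=> φ; exists (num φ); case: pselect => [ex|[]]; last by exists φ.
by case: (cid ex) => ψ /= /(pcan_inj pickleK) /(fm_code_inj mi).
Qed.

Record henkin T (Δ : fm natVar -> Prop) : Prop := Henkin {
  henkin_bot : ~ Δ ⊥;
  henkin_prv : forall Γ φ, (forall ψ, List.In ψ Γ -> Δ ψ) -> prv T Γ φ -> Δ φ;
  henkin_not : forall φ, ~ Δ φ -> Δ (¬ φ);
  henkin_wit : forall σ (φ : fm (ext natVar σ)), Δ (Ex σ φ) -> exists t, Δ (inst t φ) }.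

(** Stage n+1 accepts the formula [e n], together with an instance if it is existential, whenever
    this keeps the stage consistent. As every formula is enumerated, the union of the stages decides
    every formula. *)
Theorem henkin_extension T φ0 :
  subst_closed T -> ~ prv T [::] φ0 -> exists2 Δ, henkin T Δ & Δ (¬ φ0).
Proof.
move=> Tr nφ0; have [e e_surj] := fm_enum.
(* [Γ'] is one witnessing instance if [φ] is existential and is empty otherwise. *)
have wit Γ φ : exists Γ' : list (fm natVar),
    [/\ ~ prv T (φ :: Γ) ⊥ -> ~ prv T (Γ' ++ φ :: Γ) ⊥ &
      forall σ ψ, φ = Ex σ ψ -> exists t, List.In (inst t ψ) Γ'].
  have [[σ [ψ φE]]|nex] := EM (exists σ ψ, φ = Ex σ ψ); last first.
    by exists [::]; split=> // σ ψ φE; case: nex; exists σ, ψ.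
  have [|t tP] := prv_witness (T := T) (Γ := φ :: Γ) (φ := ψ) Tr; first by left.
  exists [:: inst t ψ]; split=> [n /tP //|σ' ψ' φE'].
  move: φE'; rewrite φE => -[eσ]; case: _ / eσ ψ' => ψ' /(@existT_inj (fun σ => fm (ext natVar σ))) ->.
  by exists t; left.
pose step n Γ := if pselect (prv T (e n :: Γ) ⊥) then Γ else
  projT1 (cid (wit Γ (e n))) ++ e n :: Γ.
pose stage := fix stage n := if n is n.+1 then step n (stage n) else [:: ¬ φ0].
have stage_mono n m φ : (n <= m)%N -> List.In φ (stage n) -> List.In φ (stage m).
  elim: m => [|m IH]; first by rewrite leqn0 => /eqP ->.
  rewrite leq_eqVlt => /orP[/eqP -> //|nm h]; rewrite /= /step.
  have {}h := IH nm h; by case: pselect => //= _; apply/List.in_or_app; right; right.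
have stage_con n : ~ prv T (stage n) ⊥.
  elim: n => [/prvRAA //|n IH] /=; rewrite /step; case: pselect => //= con.
  by case: cid => Γ' [h _] /=; apply: h.
pose Δ φ := exists n, List.In φ (stage n).
have bound Γ : (forall ψ, List.In ψ Γ -> Δ ψ) ->
    exists n, forall ψ, List.In ψ Γ -> List.In ψ (stage n).
  elim: Γ => [_|ψ Γ IH h]; first by exists 0%N.
  have [|n nP] := IH; first by move=> χ χΓ; apply: h; right.
  have [m mP] := h ψ (or_introl erefl).
  exists (maxn n m) => χ [<-|/nP h'].
    exact: stage_mono (leq_maxr _ _) mP.
  exact: stage_mono (leq_maxl _ _) h'.
have in_next n : ~ prv T (e n :: stage n) ⊥ -> List.In (e n) (stage n.+1).
  by move=> con /=; rewrite /step; case: pselect => //= _; apply/List.in_or_app; right; left.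
(* A consequence [φ] of [Δ] is never rejected: a refutation at its own stage, combined with its
   derivation, would make some later stage inconsistent. *)
have Δprv Γ φ : (forall ψ, List.In ψ Γ -> Δ ψ) -> prv T Γ φ -> Δ φ.
  move=> /bound[n nP] p; have [m mE] := e_surj φ; exists m.+1; rewrite -mE.
  apply: in_next; rewrite mE => p'; apply: (stage_con (maxn n m)).
  apply: (@prvIE _ _ _ φ).
    apply: prvII; apply: prv_weaken p' _ => ψ [->|]; first by left.
    by move=> h; right; apply: stage_mono (leq_maxr _ _) h.
  by apply: prv_weaken p _ => ψ /nP; apply: stage_mono (leq_maxl _ _).
exists Δ; last by exists 0%N; left.
split=> //.
- by move=> [n h]; apply: (stage_con n); exact: prvHyp.
- move=> φ nφ; have [n nE] := e_surj φ.
  have [p|/in_next] := EM (prv T (e n :: stage n) ⊥); last first.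
    by rewrite nE => h; case: nφ; exists n.+1.
  apply: (Δprv (stage n)); first by move=> ψ; exists n.
  by rewrite -nE; exact: prvII.
- move=> σ φ [k kP]; have [n nE] := e_surj (Ex σ φ).
  (* The existential formula may have entered at another stage [k], without a witness. Being
     consistent with stage [n], it is accepted at its own turn too, and then its witness is
     added. *)
  have con : ~ prv T (e n :: stage n) ⊥.
    move=> p; apply: (stage_con (maxn n k)); apply: (@prvIE _ _ _ (e n)).
      apply: prvII; apply: prv_weaken p _ => ψ [->|h]; [by left|right].
      exact: stage_mono (leq_maxl _ _) h.
    by apply: prvHyp; rewrite nE; apply: stage_mono (leq_maxr _ _) kP.
  have: exists t, List.In (inst t φ) (stage n.+1).
    rewrite /= /step; case: pselect => //= _; case: cid => Γ' [_ h] /=.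
    by have [t tP] := h _ _ nE; exists t; apply/List.in_or_app; left.
  by move=> [t tP]; exists t, n.+1.
Qed.

(** * Structures and completeness *)

Section Quotient.
Variables (X : Set) (e : X -> X -> Prop).
Hypotheses (e_refl : forall x, e x x) (e_sym : forall x y, e x y -> e y x)
  (e_trans : forall x y z, e x y -> e y z -> e x z).

(** Related elements have equal predicates [e x], so choice picks the same representative for them.
    The quotient is the set of chosen representatives and thus stays in [Set]. *)
Definition canon (x : X) : X := projT1 (cid (ex_intro (e x) x (e_refl x))).

Lemma canonP x : e x (canon x). Proof. exact: projT2 (cid _). Qed.

Lemma canon_eq x y : e x y -> canon x = canon y.
Proof.
move=> exy; rewrite /canon.
move: (ex_intro (e x) x (e_refl x)) (ex_intro (e y) y (e_refl y)).
have -> : e x = e y.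
  apply: funext => z; apply: propext; split; first exact/e_trans/e_sym.
  exact: e_trans.
by move=> p q; rewrite (Prop_irrelevance p q).
Qed.

Definition quot : Set := {x : X | canon x = x}.
Definition repr (q : quot) : X := proj1_sig q.
Definition cls (x : X) : quot := exist _ (canon x) (esym (canon_eq (canonP x))).

Lemma cls_eq x y : cls x = cls y <-> e x y.
Proof.
split=> [/(congr1 repr) /= xy|/canon_eq xy].
  by apply: e_trans (canonP x) _; rewrite xy; apply/e_sym/canonP.
exact: eq_exist.
Qed.

Lemma reprK q : cls (repr q) = q.
Proof. by case: q => x xE; apply: eq_exist. Qed.

End Quotient.

(** The domains lie in [Set] so that the family [dom M] can itself be a context, whose variables
    name the elements of the model. *)
Record structure : Type := Structure {
  dom : ty -> Set;
  app : forall σ τ, dom (σ ⇾ τ) -> dom σ -> dom τ;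
  const : forall τ, cst τ -> dom τ;
  less : dom tO -> dom tO -> Prop }.
Arguments app {s σ τ}.
Arguments const {s τ}.
Arguments less {s}.

Definition extensional (M : structure) :=
  forall σ τ (f g : dom M (σ ⇾ τ)), (forall x, app f x = app g x) -> f = g.

Definition env (M : structure) (V : ty -> Set) := forall τ, V τ -> dom M τ.

Definition econs (M : structure) V σ (d : dom M σ) (ρ : env M V) : env M (ext V σ) :=
  fun _ v => match v in ext _ _ τ return dom M σ -> dom M τ with
             | new => fun d => d
             | old v => fun _ => ρ _ v
             end d.

Fixpoint teval (M : structure) V (ρ : env M V) τ (s : tm V τ) : dom M τ :=
  match s with
  | Var v => ρ _ v
  | Cst c => const c
  | App f s => app (teval ρ f) (teval ρ s)
  end.

Fixpoint feval (M : structure) V (ρ : env M V) (φ : fm V) : Prop :=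
  match φ with
  | Eq s t => teval ρ s = teval ρ t
  | Lt s t => less (teval ρ s) (teval ρ t)
  | Bot => False
  | Imp φ ψ => feval ρ φ -> feval ρ ψ
  | And φ ψ => feval ρ φ /\ feval ρ ψ
  | Or φ ψ => feval ρ φ \/ feval ρ ψ
  | All σ φ => forall d : dom M σ, feval (econs d ρ) φ
  | Ex σ φ => exists d : dom M σ, feval (econs d ρ) φ
  end.

Definition satisfies (M : structure) (T : forall V, fm V -> Prop) :=
  forall V (ρ : env M V) φ, T V φ -> feval ρ φ.

Lemma teval_tsub (M : structure) V W (r : sub V W) (ρ : env M W) τ (s : tm V τ) :
  teval ρ (tsub r s) = teval (fun _ v => teval ρ (r _ v)) s.
Proof. by elim: s => //= σ {}τ f -> s ->. Qed.

Lemma teval_twk (M : structure) V (ρ : env M V) σ (d : dom M σ) τ (s : tm V τ) :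
  teval (econs d ρ) (twk σ s) = teval ρ s.
Proof. by rewrite /twk tren_tsub teval_tsub. Qed.

Lemma feval_fsub (M : structure) V W (r : sub V W) (ρ : env M W) (φ : fm V) :
  feval ρ (fsub r φ) = feval (fun _ v => teval ρ (r _ v)) φ.
Proof.
have liftE V' W' (r' : sub V' W') (ρ' : env M W') σ (d : dom M σ) :
    (fun _ v => teval (econs d ρ') (slift r' v)) =
    econs d (fun _ v => teval ρ' (r' _ v)).
  by apply: ext_funext => //= τ v; rewrite teval_twk.
elim: φ W r ρ => [V' s t|V' s t|V'|V' φ IH1 ψ IH2|V' φ IH1 ψ IH2|V' φ IH1 ψ IH2
  |V' σ φ IH|V' σ φ IH] W r ρ //=; rewrite ?teval_tsub ?IH1 ?IH2 //.
- by apply: eq_forall => d; rewrite IH liftE.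
- by apply: eq_exists => d; rewrite IH liftE.
Qed.

Lemma feval_inst (M : structure) V (ρ : env M V) σ (s : tm V σ) (φ : fm (ext V σ)) :
  feval ρ (inst s φ) = feval (econs (teval ρ s) ρ) φ.
Proof. by rewrite /inst feval_fsub; congr (feval _ _); apply: ext_funext. Qed.

Lemma feval_EqT (M : structure) V (ρ : env M V) τ (s t : tm V τ) :
  extensional M -> feval ρ (EqT s t) <-> teval ρ s = teval ρ t.
Proof.
move=> Mext; elim: τ V ρ s t => [|σ _ τ IH] V ρ s t //=; split=> [h|st d].
  by apply: Mext => d; have /IH := h d; rewrite /= !teval_twk.
by apply/IH; rewrite /= !teval_twk st.
Qed.

Lemma inst_new V σ (φ : fm (ext V σ)) :
  inst (Var new) (fren (rlift (fun _ v => old v)) φ) = φ.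
Proof.
rewrite /inst fren_fsub fsub_fsub -[RHS]fsub_id.
by congr (fsub _ _); apply: ext_funext.
Qed.

(** * The term model of a Henkin theory *)

Section TermModel.
Variables (T : forall V, fm V -> Prop) (Δ : fm natVar -> Prop).
Hypotheses (Tr : subst_closed T) (ΔP : henkin T Δ).
Hypothesis T_refl : forall V (x : tm V tO), prv T [::] (x ≐ x).
Hypothesis T_sym : forall V (x y : tm V tO), prv T [::] (x ≐ y ⟶ y ≐ x).
Hypothesis T_trans : forall V (x y z : tm V tO), prv T [::] (x ≐ y ⟶ y ≐ z ⟶ x ≐ z).
Hypothesis T_lt : forall V (x x' y y' : tm V tO),
  prv T [::] (x ≐ x' ⟶ y ≐ y' ⟶ x ≺ y ⟶ x' ≺ y').
Hypothesis T_ext : forall V ρ τ (x y : tm V ρ) (f : tm V (ρ ⇾ τ)),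
  prv T [::] (x ≗ y ⟶ f · x ≗ f · y).

Lemma henkin0 φ : prv T [::] φ -> Δ φ.
Proof. exact: henkin_prv ΔP [::] φ _. Qed.

Lemma henkin1 φ ψ : Δ φ -> prv T [:: φ] ψ -> Δ ψ.
Proof. by move=> Δφ; apply: (henkin_prv ΔP) => ? [<-|]. Qed.

Lemma henkin_imp φ ψ : Δ (φ ⟶ ψ) <-> (Δ φ -> Δ ψ).
Proof.
split=> [Δi Δφ|h].
  apply: (henkin_prv ΔP (Γ := [:: φ ⟶ ψ; φ])); first by move=> ? [<-|[<-|]].
  by apply: (@prvIE _ _ _ φ); apply: prvHyp; [left|right; left].
have [/h Δψ|/(henkin_not ΔP) Δn] := EM (Δ φ).
  by apply: (henkin1 Δψ); apply/prvII/prvHyp; right; left.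
apply: (henkin1 Δn); apply/prvII/prvRAA.
by apply: (@prvIE _ _ _ φ); apply: prvHyp; [right; right; left|right; left].
Qed.

Lemma henkin_and φ ψ : Δ (φ ∧ ψ) <-> Δ φ /\ Δ ψ.
Proof.
split=> [h|[Δφ Δψ]].
  by split; apply: (henkin1 h); [apply: prvAE1|apply: prvAE2]; apply: prvHyp; left.
apply: (henkin_prv ΔP (Γ := [:: φ; ψ])); first by move=> ? [<-|[<-|]].
by apply: prvAI; apply: prvHyp; [left|right; left].
Qed.

Lemma henkin_or φ ψ : Δ (φ ∨ ψ) <-> Δ φ \/ Δ ψ.
Proof.
split=> [h|[h|h]]; last 2 first.
- by apply: (henkin1 h); apply/prvOI1/prvHyp; left.
- by apply: (henkin1 h); apply/prvOI2/prvHyp; left.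
apply: contrapT => /not_orP[/(henkin_not ΔP) nφ /(henkin_not ΔP) nψ].
apply: (henkin_bot ΔP).
apply: (henkin_prv ΔP (Γ := [:: φ ∨ ψ; ¬ φ; ¬ ψ])); first by move=> ? [<-|[<-|[<-|]]].
apply: (@prvOE _ _ _ φ ψ); first by apply: prvHyp; left.
  by apply: (@prvIE _ _ _ φ); apply: prvHyp; [do 2 right; left|left].
by apply: (@prvIE _ _ _ ψ); apply: prvHyp; [do 3 right; left|left].
Qed.

Lemma henkin_ex σ (φ : fm (ext natVar σ)) : Δ (Ex σ φ) <-> exists t, Δ (inst t φ).
Proof.
split=> [/(henkin_wit ΔP) //|[t h]]; apply: (henkin1 h).
by apply: (@prvEI _ _ _ _ _ t); apply: prvHyp; left.
Qed.

(** If the universal formula is missing, its negation is in [Δ]; classically this gives an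
    existential counterexample, whose witness contradicts one of the instances. *)
Lemma henkin_all σ (φ : fm (ext natVar σ)) : Δ (All σ φ) <-> forall t, Δ (inst t φ).
Proof.
split=> [h t|h]; first by apply: (henkin1 h); apply/prvUE/prvHyp; left.
apply: contrapT => /(henkin_not ΔP) n.
have /henkin_ex[t] : Δ (Ex σ (¬ φ)).
  apply: (henkin1 n); apply: prvRAA.
  apply: (@prvIE _ _ _ (All σ φ)); first by apply: prvHyp; right; left.
  apply/prvUI/prvRAA; apply: (@prvIE _ _ _ (fwk σ (Ex σ (¬ φ)))).
    by apply: prvHyp; right; left.
  apply: (@prvEI _ _ _ _ _ (Var new)); apply: prvHyp; left.
  exact: esym (inst_new (¬ φ)).
by rewrite [inst _ _]/= => /henkin_imp /(_ (h t)); exact: henkin_bot ΔP.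
Qed.

Definition teq τ (s t : tm natVar τ) : Prop := Δ (EqT s t).

Lemma teq_arr σ τ (f g : tm natVar (σ ⇾ τ)) :
  teq f g <-> forall u, teq (App f u) (App g u).
Proof.
rewrite /teq /= henkin_all; split=> h u; have := h u;
  by rewrite /inst tsub_EqT /= !tsub_scons_twk !tsub_id.
Qed.

Lemma teq_refl τ (s : tm natVar τ) : teq s s.
Proof.
elim: τ s => [|σ _ τ IH] s; first exact/henkin0/T_refl.
by apply/teq_arr => u; exact: IH.
Qed.

Lemma teq_sym τ (s t : tm natVar τ) : teq s t -> teq t s.
Proof.
elim: τ s t => [|σ _ τ IH] s t; first exact/henkin_imp/henkin0/T_sym.
by move=> /teq_arr st; apply/teq_arr => u; exact: IH.
Qed.

Lemma teq_trans τ (s t u : tm natVar τ) : teq s t -> teq t u -> teq s u.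
Proof.
elim: τ s t u => [|σ _ τ IH] s t u.
  by move=> st; apply/henkin_imp; move: st; apply/henkin_imp/henkin0/T_trans.
by move=> /teq_arr st /teq_arr tu; apply/teq_arr => w; exact: IH (st w) (tu w).
Qed.

(** Congruence in the function is the definition of pointwise equality; congruence in the argument
    is the extensionality axiom. *)
Lemma teq_app σ τ (f g : tm natVar (σ ⇾ τ)) s t :
  teq f g -> teq s t -> teq (App f s) (App g t).
Proof.
move=> /teq_arr fg st; apply: teq_trans (fg _).
by move: st; apply/henkin_imp/henkin0/T_ext.
Qed.

Definition tdom (τ : ty) : Set := quot (@teq_refl τ).
Definition tcls τ : tm natVar τ -> tdom τ :=
  cls (@teq_refl τ) (@teq_sym τ) (@teq_trans τ).

Lemma tcls_eq τ (s t : tm natVar τ) : tcls s = tcls t <-> teq s t.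
Proof. exact: cls_eq. Qed.

Lemma tcls_repr τ (d : tdom τ) : tcls (repr d) = d.
Proof. exact: reprK. Qed.

Definition term_model : structure := {|
  dom := tdom;
  app := fun σ τ f s => tcls (App (repr f) (repr s));
  const := fun τ c => tcls (Cst c);
  less := fun x y => Δ (Lt (repr x) (repr y)) |}.

Lemma teq_repr τ (s : tm natVar τ) : teq (repr (tcls s)) s.
Proof. by apply/tcls_eq; rewrite tcls_repr. Qed.

Lemma term_model_ext : extensional term_model.
Proof.
move=> σ τ f g /= fg; rewrite -(tcls_repr f) -(tcls_repr g).
apply/tcls_eq/teq_arr => u; have /tcls_eq h := fg (tcls u).
apply: teq_trans (teq_trans _ h) _; apply: teq_app; try exact: teq_refl.
  exact/teq_sym/teq_repr.
exact: teq_repr.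
Qed.

Lemma term_model_teval V (θ : sub V natVar) τ (s : tm V τ) :
  teval (M := term_model) (fun _ v => tcls (θ _ v)) s = tcls (tsub θ s).
Proof.
elim: s => //= σ {}τ f -> s ->; apply/tcls_eq.
by apply: teq_app; exact: teq_repr.
Qed.

Lemma term_model_econs V (θ : sub V natVar) σ (t : tm natVar σ) :
  econs (M := term_model) (tcls t) (fun _ v => tcls (θ _ v)) =
  fun _ v => tcls (scons t θ v).
Proof. exact: ext_funext. Qed.

(** Truth lemma: each connective is a closure property of [Δ], and quantifying over classes is
    quantifying over terms because every class has a representative. *)
Lemma term_model_feval V (θ : sub V natVar) (φ : fm V) :
  feval (M := term_model) (fun _ v => tcls (θ _ v)) φ <-> Δ (fsub θ φ).
Proof.
elim: φ θ => [V' s t|V' s t|V'|V' φ IH1 ψ IH2|V' φ IH1 ψ IH2|V' φ IH1 ψ IH2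
  |V' σ φ IH|V' σ φ IH] θ /=.
- by rewrite !term_model_teval; exact: tcls_eq.
- rewrite !term_model_teval.
  have lt_imp x x' y y' : teq x x' -> teq y y' -> Δ (x ≺ y) -> Δ (x' ≺ y').
    move=> xx' yy'; apply/henkin_imp; move: yy'; apply/henkin_imp; move: xx'.
    exact/henkin_imp/henkin0/T_lt.
  split; first by apply: lt_imp; exact: teq_repr.
  by apply: lt_imp; apply: teq_sym; exact: teq_repr.
- by split=> // /(henkin_bot ΔP).
- by rewrite henkin_imp IH1 IH2.
- by rewrite henkin_and IH1 IH2.
- by rewrite henkin_or IH1 IH2.
- rewrite henkin_all; split=> [h t|h d].
    by rewrite inst_slift; apply/IH; rewrite -term_model_econs; exact: h.
  by rewrite -(tcls_repr d) term_model_econs; apply/IH; rewrite -inst_slift.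
- rewrite henkin_ex; split=> [[d]|[t]].
    rewrite -(tcls_repr d) term_model_econs => /IH h.
    by exists (repr d); rewrite inst_slift.
  by rewrite inst_slift => /IH; rewrite -term_model_econs; exists (tcls t).
Qed.

Lemma term_model_sat : satisfies term_model T.
Proof.
move=> V ρ φ Tφ.
have -> : ρ = fun _ v => tcls (repr (ρ _ v)).
  by apply: functional_extensionality_dep => τ; apply: functional_extensionality_dep => v;
    rewrite tcls_repr.
exact/term_model_feval/henkin0/prvT/Tr.
Qed.

End TermModel.

Fixpoint closed_tm (τ : ty) : tm noVar τ :=
  match τ with
  | tO => Cst c0
  | Arr σ τ => App (Cst (cK τ σ)) (closed_tm τ)
  end.

Theorem completeness (φ : fm noVar) :
  (forall (M : structure) (ρ : env M noVar),
     extensional M -> satisfies M RCA0w -> feval ρ φ) ->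
  RCA0w_proves φ.
Proof.
move=> valid; apply: contrapT => nφ.
pose θ : sub noVar natVar := fun _ v => match v with end.
(* The Henkin construction needs variables, so the closed formula is moved to [natVar]. A proof
   there would come back by substituting a closed term for every variable, all types being
   inhabited. *)
have nφ' : ~ prv RCA0w [::] (fsub θ φ).
  move=> /(prv_fsub (fun τ _ => closed_tm τ) RCA0w_subst).
  rewrite fsub_fsub /= (_ : (fun _ _ => _) = idsub) ?fsub_id //.
  by apply: functional_extensionality_dep => τ; apply: functional_extensionality_dep => -[].
have [Δ ΔP Δnφ] := henkin_extension RCA0w_subst nφ'.
have ax V (ψ : fm V) : RCA0w ψ -> prv RCA0w [::] ψ by exact: prvT.
have rfl V (x : tm V tO) := ax _ _ (ax_refl x).
have sym V (x y : tm V tO) := ax _ _ (ax_sym x y).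
have trn V (x y z : tm V tO) := ax _ _ (ax_trans x y z).
have lt V (x x' y y' : tm V tO) := ax _ _ (ax_ltE x x' y y').
have ext' V ρ τ (x y : tm V ρ) (f : tm V (ρ ⇾ τ)) := ax _ _ (ax_ext x y f).
pose M := term_model ΔP rfl sym trn.
have := valid M (fun τ v => tcls ΔP rfl sym trn (θ τ v)).
move=> /(_ (term_model_ext ext') (term_model_sat RCA0w_subst lt ext')).
move=> /(term_model_feval _ rfl sym trn lt ext') Δφ.
by move: Δnφ => /(henkin_imp ΔP) /(_ Δφ) /(henkin_bot ΔP).
Qed.

(** * Fractions of an ordered semiring *)

(** The last field joins discreteness and subtraction: a positive difference has the form 1 + z,
    which is exactly the form of the denominators used below. *)
Record osemiring := OSemiring {
  osort :> Set;
  ozero : osort; oone : osort;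
  oadd : osort -> osort -> osort; omul : osort -> osort -> osort;
  olt : osort -> osort -> Prop;
  o_th : semi_ring_theory ozero oone oadd omul eq;
  olt_irr : forall x, ~ olt x x;
  olt_trans : forall x y z, olt x y -> olt y z -> olt x z;
  olt_total : forall x y, [\/ olt x y, x = y | olt y x];
  olt_add : forall x y z, olt x y -> olt (oadd x z) (oadd y z);
  olt_mul : forall x y z, olt ozero z -> olt x y -> olt (omul x z) (omul y z);
  olt01 : olt ozero oone;
  ole0 : forall x, olt ozero x \/ x = ozero;
  olt_sub : forall x y, olt x y -> exists z, y = oadd (oadd x oone) z }.

Section Fractions.
Variable N : osemiring.
Notation "0" := (ozero N).
Notation "1" := (oone N).
Infix "+" := (@oadd N).
Infix "*" := (@omul N).
Infix "<" := (@olt N).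

Add Ring osemiring_ring : (o_th N).

Lemma olt_eq (x x' y y' : N) : x = x' -> y = y' -> x < y -> x' < y'.
Proof. by move=> -> ->. Qed.

Lemma oaddI (z x y : N) : x + z = y + z -> x = y.
Proof. by move=> h; case: (olt_total x y) => // /(olt_add z); rewrite h => /olt_irr. Qed.

Lemma olt_addE (z x y : N) : x + z < y + z <-> x < y.
Proof.
split; last exact: olt_add.
case: (olt_total x y) => // [->|/(olt_add z) h /(olt_trans h)]; first by move/olt_irr.
by move/olt_irr.
Qed.

Lemma omulI (z x y : N) : 0 < z -> x * z = y * z -> x = y.
Proof.
by move=> z0 h; case: (olt_total x y) => // /(olt_mul z0); rewrite h => /olt_irr.
Qed.

Lemma olt_mulE (z x y : N) : 0 < z -> x * z < y * z <-> x < y.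
Proof.
move=> z0; split; last exact: olt_mul.
case: (olt_total x y) => // [->|/(olt_mul z0) h /(olt_trans h)]; first by move/olt_irr.
by move/olt_irr.
Qed.

Lemma osucc_gt0 (x : N) : 0 < 1 + x.
Proof.
case: (ole0 x) => [x0|->]; last by (have -> : 1 + 0 = 1 by ring); exact: olt01.
apply: (olt_trans x0); have := olt_add x (olt01 N).
by have -> : 0 + x = x by ring.
Qed.

(* [Pre a b d] stands for the fraction (a - b) / (1 + d). *)
Record prefrac : Set := Pre { pp : N; pn : N; pd : N }.

Definition peq (x y : prefrac) :=
  pp x * (1 + pd y) + pn y * (1 + pd x) = pp y * (1 + pd x) + pn x * (1 + pd y).
Definition plt (x y : prefrac) :=
  pp x * (1 + pd y) + pn y * (1 + pd x) < pp y * (1 + pd x) + pn x * (1 + pd y).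
Definition padd (x y : prefrac) :=
  Pre (pp x * (1 + pd y) + pp y * (1 + pd x)) (pn x * (1 + pd y) + pn y * (1 + pd x))
    (pd x + pd y + pd x * pd y).
Definition pmul (x y : prefrac) :=
  Pre (pp x * pp y + pn x * pn y) (pp x * pn y + pn x * pp y) (pd x + pd y + pd x * pd y).
Definition popp (x : prefrac) := Pre (pn x) (pp x) (pd x).

Lemma peq_refl x : peq x x. Proof. by rewrite /peq; ring. Qed.

Lemma peq_sym x y : peq x y -> peq y x. Proof. by rewrite /peq => ->. Qed.

(** In the absence of subtraction, the middle fraction is eliminated by cancellation: of its
    denominator as a factor, and of its two numerators as summands. *)
Lemma peq_trans x y z : peq x y -> peq y z -> peq x z.
Proof.
case: x y z => [a b d] [a1 b1 d1] [a2 b2 d2]; rewrite /peq /= => h1 h2.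
apply: (omulI (osucc_gt0 d1)); apply: (oaddI (z := (a1 + b1) * (1 + d) * (1 + d2))).
transitivity ((a * (1 + d1) + b1 * (1 + d)) * (1 + d2)
  + (a1 * (1 + d2) + b2 * (1 + d1)) * (1 + d)); first by ring.
by rewrite h1 h2; ring.
Qed.

Lemma plt_peql x x' y : peq x x' -> plt x y -> plt x' y.
Proof.
case: x x' y => [a b d] [a1 b1 d1] [a2 b2 d2]; rewrite /peq /plt /= => h1 h2.
apply/(olt_mulE _ _ (osucc_gt0 d))/(olt_addE (b * (1 + d1) * (1 + d2))).
have -> : (a1 * (1 + d2) + b2 * (1 + d1)) * (1 + d) + b * (1 + d1) * (1 + d2) =
    (a * (1 + d2) + b2 * (1 + d)) * (1 + d1) + b1 * (1 + d) * (1 + d2).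
  transitivity ((a1 * (1 + d) + b * (1 + d1)) * (1 + d2) + b2 * (1 + d1) * (1 + d)).
    by ring.
  by rewrite -h1; ring.
have -> : (a2 * (1 + d1) + b1 * (1 + d2)) * (1 + d) + b * (1 + d1) * (1 + d2) =
    (a2 * (1 + d) + b * (1 + d2)) * (1 + d1) + b1 * (1 + d) * (1 + d2) by ring.
exact/olt_add/olt_mul/h2/osucc_gt0.
Qed.

Lemma plt_popp x y : plt x y -> plt (popp y) (popp x).
Proof.
rewrite /plt /=; apply: olt_eq; ring.
Qed.

Lemma peq_popp x y : peq x y -> peq (popp x) (popp y).
Proof.
rewrite /peq /= => h; rewrite [LHS](_ : _ = pp y * (1 + pd x) + pn x * (1 + pd y)).
  by rewrite -h; ring.
by ring.
Qed.

Lemma poppK x : popp (popp x) = x. Proof. by case: x. Qed.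

(** Negation exchanges the two sides, so compatibility on the left also gives it on the right. *)
Lemma plt_peq x x' y y' : peq x x' -> peq y y' -> plt x y <-> plt x' y'.
Proof.
have h z z' w w' : peq z z' -> peq w w' -> plt z w -> plt z' w'.
  move=> zz' /peq_popp ww' /(plt_peql zz') /plt_popp /(plt_peql ww') /plt_popp.
  by rewrite !poppK.
by move=> xx' yy'; split; apply: h => //; exact: peq_sym.
Qed.

Lemma paddC x y : padd x y = padd y x.
Proof. by rewrite /padd; congr Pre; ring. Qed.

Lemma pmulC x y : pmul x y = pmul y x.
Proof. by rewrite /pmul; congr Pre; ring. Qed.

Lemma peq_padd x x' y y' : peq x x' -> peq y y' -> peq (padd x y) (padd x' y').
Proof.
have h z z' w : peq z z' -> peq (padd z w) (padd z' w).
  case: z z' w => [a b d] [a1 b1 d1] [a2 b2 d2]; rewrite /peq /= => h.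
  transitivity ((a * (1 + d1) + b1 * (1 + d)) * (1 + d2) * (1 + d2) +
    (a2 + b2) * (1 + d) * (1 + d1) * (1 + d2)); first by ring.
  by rewrite h; ring.
move=> xx' yy'; apply: peq_trans (h _ _ y xx') _.
by rewrite ![padd x' _]paddC; apply: h.
Qed.

Lemma peq_pmul x x' y y' : peq x x' -> peq y y' -> peq (pmul x y) (pmul x' y').
Proof.
have h z z' w : peq z z' -> peq (pmul z w) (pmul z' w).
  case: z z' w => [a b d] [a1 b1 d1] [a2 b2 d2]; rewrite /peq /= => h.
  transitivity ((a * (1 + d1) + b1 * (1 + d)) * a2 * (1 + d2) +
    (a1 * (1 + d) + b * (1 + d1)) * b2 * (1 + d2)); first by ring.
  transitivity ((a1 * (1 + d) + b * (1 + d1)) * a2 * (1 + d2) +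
    (a * (1 + d1) + b1 * (1 + d)) * b2 * (1 + d2)); first by rewrite h.
  by ring.
move=> xx' yy'; apply: peq_trans (h _ _ y xx') _.
by rewrite ![pmul x' _]pmulC; apply: h.
Qed.

Definition frac : Set := quot peq_refl.
Definition fcls : prefrac -> frac := cls peq_refl peq_sym peq_trans.

Lemma fcls_eq x y : fcls x = fcls y <-> peq x y. Proof. exact: cls_eq. Qed.

Lemma fcls_surj (P : frac -> Prop) : (forall x, P (fcls x)) -> forall k, P k.
Proof. by move=> h k; rewrite -(reprK peq_sym peq_trans k). Qed.

Lemma peq_repr x : peq (repr (fcls x)) x.
Proof. by apply/fcls_eq; exact: reprK. Qed.

Definition fadd (k l : frac) := fcls (padd (repr k) (repr l)).
Definition fmul (k l : frac) := fcls (pmul (repr k) (repr l)).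
Definition fopp (k : frac) := fcls (popp (repr k)).
Definition flt (k l : frac) : bool := `[< plt (repr k) (repr l) >].

Lemma faddE x y : fadd (fcls x) (fcls y) = fcls (padd x y).
Proof. exact/fcls_eq/peq_padd/peq_repr/peq_repr. Qed.

Lemma fmulE x y : fmul (fcls x) (fcls y) = fcls (pmul x y).
Proof. exact/fcls_eq/peq_pmul/peq_repr/peq_repr. Qed.

Lemma foppE x : fopp (fcls x) = fcls (popp x).
Proof. exact/fcls_eq/peq_popp/peq_repr. Qed.

Lemma fltE x y : flt (fcls x) (fcls y) = `[< plt x y >].
Proof. apply/asbool_equiv_eq/plt_peq; exact: peq_repr. Qed.

Definition finj (n : N) := fcls (Pre n 0 0).

HB.instance Definition _ := gen_eqMixin frac.
HB.instance Definition _ := gen_choiceMixin frac.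

Lemma faddA : associative fadd.
Proof.
elim/fcls_surj => x; elim/fcls_surj => y; elim/fcls_surj => z; rewrite !faddE.
by apply/fcls_eq; rewrite /peq /=; ring.
Qed.

Lemma faddC : commutative fadd.
Proof. by elim/fcls_surj => x; elim/fcls_surj => y; rewrite !faddE paddC. Qed.

Lemma fadd0 : left_id (finj 0) fadd.
Proof. by elim/fcls_surj => x; rewrite faddE; apply/fcls_eq; rewrite /peq /=; ring. Qed.

Lemma faddN : left_inverse (finj 0) fopp fadd.
Proof. by elim/fcls_surj => x; rewrite foppE faddE; apply/fcls_eq; rewrite /peq /=; ring. Qed.

HB.instance Definition _ := GRing.isZmodule.Build frac faddA faddC fadd0 faddN.

Lemma fmulA : associative fmul.
Proof.
elim/fcls_surj => x; elim/fcls_surj => y; elim/fcls_surj => z; rewrite !fmulE.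
by apply/fcls_eq; rewrite /peq /=; ring.
Qed.

Lemma fmulC : commutative fmul.
Proof. by elim/fcls_surj => x; elim/fcls_surj => y; rewrite !fmulE pmulC. Qed.

Lemma fmul1 : left_id (finj 1) fmul.
Proof. by elim/fcls_surj => x; rewrite fmulE; apply/fcls_eq; rewrite /peq /=; ring. Qed.

Lemma fmulDl : left_distributive fmul fadd.
Proof.
elim/fcls_surj => x; elim/fcls_surj => y; elim/fcls_surj => z.
by rewrite !(fmulE, faddE) ; apply/fcls_eq; rewrite /peq /=; ring.
Qed.

Lemma finj_inj : injective finj.
Proof.
move=> m n /fcls_eq; rewrite /peq /= => h.
by transitivity (m * (1 + 0) + 0 * (1 + 0)); [ring|rewrite h; ring].
Qed.

Lemma fone_neq0 : finj 1 != finj 0.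
Proof.
by apply/eqP => /finj_inj h; have := olt01 N; rewrite h => /olt_irr.
Qed.

HB.instance Definition _ :=
  GRing.Zmodule_isComNzRing.Build frac fmulA fmulC fmul1 fmulDl fone_neq0.

(** The numerator a - b is 1 + c or -(1 + c), so the inverse of (a - b) / (1 + d) is, up to sign, (1
    + d) / (1 + c). *)
Lemma fmul_inv (k : frac) : k != finj 0 -> exists l, fmul l k = finj 1.
Proof.
elim/fcls_surj: k => -[a b d] /eqP nz; case: (olt_total a b) => h.
- have [c bE] := olt_sub h; exists (fcls (Pre 0 (1 + d) c)).
  by rewrite fmulE; apply/fcls_eq; rewrite /peq /= bE; ring.
- by case: nz; apply/fcls_eq; rewrite /peq /= h; ring.
- have [c aE] := olt_sub h; exists (fcls (Pre (1 + d) 0 c)).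
  by rewrite fmulE; apply/fcls_eq; rewrite /peq /= aE; ring.
Qed.

(** The default value [k] makes the inverse of 0 equal to 0, as the field interface demands. *)
Definition finv (k : frac) : frac :=
  if pselect (k != finj 0) is left nz then projT1 (cid (fmul_inv nz)) else k.

Lemma fmulV (k : frac) : k != 0%R -> (finv k * k = 1)%R.
Proof.
rewrite /finv => nz; case: pselect => [nz'|] /=; last by move/(_ nz).
by case: cid.
Qed.

Lemma finv0 : finv 0%R = 0%R.
Proof. by rewrite /finv; case: pselect => // nz; case/eqP: (nz). Qed.

HB.instance Definition _ := GRing.ComNzRing_isField.Build frac fmulV finv0.

Definition fle (k l : frac) : bool := (k == l) || flt k l.
Definition fnorm (k : frac) : frac := if flt k 0%R then (- k)%R else k.

Lemma flt0E x : flt 0%R (fcls x) = `[< pn x < pp x >].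
Proof.
rewrite fltE; apply: asbool_equiv_eq; rewrite /plt /=.
by split; apply: olt_eq; ring.
Qed.

Lemma fltE0 x : flt (fcls x) 0%R = `[< pp x < pn x >].
Proof.
rewrite fltE; apply: asbool_equiv_eq; rewrite /plt /=.
by split; apply: olt_eq; ring.
Qed.

Lemma fsub_gt0 (k l : frac) : flt 0%R (l - k)%R = flt k l.
Proof.
elim/fcls_surj: k => x; elim/fcls_surj: l => y.
rewrite [(_ - _)%R](_ : _ = fcls (padd y (popp x))); last by rewrite -faddE -foppE.
rewrite flt0E fltE; apply: asbool_equiv_eq; rewrite /plt /=.
by split; apply: olt_eq; ring.
Qed.

Lemma fgt0_add (k l : frac) : flt 0%R k -> flt 0%R l -> flt 0%R (k + l)%R.
Proof.
elim/fcls_surj: k => x; elim/fcls_surj: l => y.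
rewrite [(_ + _)%R](_ : _ = fcls (padd x y)) ?flt0E; last by rewrite -faddE.
move=> /asboolP hx /asboolP hy; apply/asboolP => /=.
apply: (@olt_trans _ _ (pp x * (1 + pd y) + pn y * (1 + pd x))).
  exact/olt_add/olt_mul/hx/osucc_gt0.
apply: olt_eq (olt_add (pp x * (1 + pd y)) (olt_mul (osucc_gt0 (pd x)) hy)); ring.
Qed.

Lemma fgt0_mul (k l : frac) : flt 0%R k -> flt 0%R l -> flt 0%R (k * l)%R.
Proof.
elim/fcls_surj: k => x; elim/fcls_surj: l => y.
rewrite [(_ * _)%R](_ : _ = fcls (pmul x y)) ?flt0E; last by rewrite -fmulE.
move=> /asboolP hx /asboolP hy; apply/asboolP => /=.
have [c ->] := olt_sub hx.
apply: olt_eq (olt_add (pn x * pn y + pn x * pp y) (olt_mul (osucc_gt0 c) hy)); ring.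
Qed.

Lemma flt_irr (k : frac) : flt k k = false.
Proof.
elim/fcls_surj: k => x; rewrite fltE; apply/asboolPn; exact: olt_irr.
Qed.

Lemma flt_asym (k : frac) : flt 0%R k -> flt k 0%R -> False.
Proof.
elim/fcls_surj: k => x; rewrite flt0E fltE0 => /asboolP h /asboolP /(olt_trans h).
exact: olt_irr.
Qed.

Lemma flt_total (k : frac) : [|| flt 0%R k, k == 0%R | flt k 0%R].
Proof.
elim/fcls_surj: k => x; rewrite flt0E fltE0.
case: (olt_total (pn x) (pp x)) => [/asboolP -> //|h|/asboolP ->]; last by rewrite !orbT.
apply/orP; right; apply/orP; left; apply/eqP/fcls_eq; rewrite /peq /= h; ring.
Qed.

Lemma fle0_add (k l : frac) : fle 0%R k -> fle 0%R l -> fle 0%R (k + l)%R.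
Proof.
move=> /orP[/eqP <-|hk]; first by rewrite GRing.add0r.
move=> /orP[/eqP <-|hl]; first by rewrite GRing.addr0 /fle hk orbT.
by rewrite /fle fgt0_add ?orbT.
Qed.

Lemma fle0_mul (k l : frac) : fle 0%R k -> fle 0%R l -> fle 0%R (k * l)%R.
Proof.
move=> /orP[/eqP <-|hk]; first by rewrite GRing.mul0r /fle eqxx.
move=> /orP[/eqP <-|hl]; first by rewrite GRing.mulr0 /fle eqxx.
by rewrite /fle fgt0_mul ?orbT.
Qed.

Lemma fle0_anti (k : frac) : fle 0%R k -> fle k 0%R -> k = 0%R.
Proof.
by move=> /orP[/eqP <- //|hk] /orP[/eqP //|/(flt_asym hk)].
Qed.

Lemma fsub_ge0 (k l : frac) : fle 0%R (l - k)%R = fle k l.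
Proof. by rewrite /fle fsub_gt0 eq_sym GRing.subr_eq0 eq_sym. Qed.

Lemma fle0_total (k : frac) : fle 0%R k || fle k 0%R.
Proof.
rewrite /fle eq_sym; case/or3P: (flt_total k) => ->; by rewrite ?orbT.
Qed.

Lemma fopp_lt0 (k : frac) : flt (- k)%R 0%R = flt 0%R k.
Proof. by rewrite -fsub_gt0 GRing.sub0r GRing.opprK. Qed.

Lemma fnormN (k : frac) : fnorm (- k)%R = fnorm k.
Proof.
rewrite /fnorm fopp_lt0; case/or3P: (flt_total k) => [h|/eqP ->|h].
- by rewrite h GRing.opprK; case: ifP => // /(flt_asym h).
- by rewrite !GRing.oppr0.
- by rewrite h; case: ifP => // /flt_asym /(_ h).
Qed.

Lemma fge0_norm (k : frac) : fle 0%R k -> fnorm k = k.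
Proof.
rewrite /fnorm => /orP[/eqP <-|h]; first by rewrite flt_irr.
by case: ifP => // /(flt_asym h).
Qed.

Lemma flt_def (k l : frac) : flt k l = (l != k) && fle k l.
Proof.
rewrite /fle eq_sym; case: eqP => [->|] //=; exact: flt_irr.
Qed.

HB.instance Definition _ := Num.IntegralDomain_isLeReal.Build frac
  fle0_add fle0_mul fle0_anti fsub_ge0 fle0_total fnormN fge0_norm flt_def.

Lemma finj_add (m n : N) : finj (m + n) = (finj m + finj n)%R.
Proof. by rewrite [RHS]faddE; apply/fcls_eq; rewrite /peq /=; ring. Qed.

Lemma finj_mul (m n : N) : finj (m * n) = (finj m * finj n)%R.
Proof. by rewrite [RHS]fmulE; apply/fcls_eq; rewrite /peq /=; ring. Qed.

Lemma finj_lt (m n : N) : m < n <-> (finj m < finj n)%R.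
Proof.
transitivity (is_true (flt (finj m) (finj n))) => //; rewrite fltE; split; rewrite asboolE /plt /=.
  by apply: olt_eq; ring.
by apply: olt_eq; ring.
Qed.

(** The field is Archimedean relative to the numbers of the model, which may be nonstandard. The
    denominator itself is a suitable multiplier, because a positive numerator is at least 1. *)
Lemma frac_arch (k : frac) : (0 < k)%R -> exists n, (1 <= finj n * k)%R.
Proof.
elim/fcls_surj: k => -[a b d] h; have {h} : flt 0%R (fcls (Pre a b d)) by [].
rewrite flt0E => /asboolP /= /olt_sub [c aE]; pose n := 1 + d; exists n.
suff -> : (finj n * fcls (Pre a b d) = finj (oone N) + finj c)%R.
  rewrite lerDl le_eqVlt; case: (ole0 c) => [/finj_lt -> |->]; first by rewrite orbT.
  by rewrite eqxx.
rewrite -finj_add [LHS]fmulE; apply/fcls_eq; rewrite /peq /= aE /n; ring.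
Qed.

End Fractions.

Theorem osemiring_embeds (N : osemiring) : exists (K : realFieldType) (ι : N -> K),
  [/\ (ι (ozero N) = 0 /\ ι (oone N) = 1)%R,
      forall x y, (ι (oadd x y) = ι x + ι y)%R,
      forall x y, (ι (omul x y) = ι x * ι y)%R,
      forall x y, olt x y <-> (ι x < ι y)%R &
      forall k : K, (0 < k)%R -> exists n, (1 <= ι n * k)%R].
Proof.
exists (frac N : realFieldType), (@finj N).
by split=> //; [exact: finj_add|exact: finj_mul|exact: finj_lt|exact: frac_arch].
Qed.

(** * Models *)

Section Model.
Variable M : structure.
Hypotheses (Mext : extensional M) (Msat : satisfies M RCA0w).

Notation N := (dom M tO).
Notation N1 := (dom M t1).

Definition zero : N := const c0.
Definition one : N := const c1.
Definition add (x y : N) : N := app (app (const cAdd) x) y.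
Definition mul (x y : N) : N := app (app (const cMul) x) y.
(** Written in the form to which [num 2] evaluates. *)
Definition two : N := add (add zero one) one.
Definition leq (x y : N) : Prop := less x y \/ x = y.

(* Every element of the model is also a variable, which names it. *)
Definition self : env M (dom M) := fun _ d => d.
Definition void : env M noVar := fun _ v => match v with end.

Lemma model_ax (φ : fm (dom M)) : RCA0w φ -> feval self φ.
Proof. exact: Msat. Qed.

Lemma app_K σ τ (x : dom M σ) (y : dom M τ) : app (app (const (cK σ τ)) x) y = x.
Proof. by have /(feval_EqT _ _ _ Mext) := model_ax (ax_K (Var x) (Var y)). Qed.

Lemma app_S ρ σ τ (x : dom M (ρ ⇾ σ ⇾ τ)) (y : dom M (ρ ⇾ σ)) (z : dom M ρ) :
  app (app (app (const (cS ρ σ τ)) x) y) z = app (app x z) (app y z).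
Proof.
by have /(feval_EqT _ _ _ Mext) := model_ax (ax_S (Var x) (Var y) (Var z)).
Qed.

Lemma teval_lam V (ρ : env M V) σ τ (s : tm (ext V σ) τ) (d : dom M σ) :
  app (teval ρ (lam s)) d = teval (econs d ρ) s.
Proof.
elim: s => [{}τ [|{}τ v]|{}τ c|σ' {}τ f IHf s IHs] /=.
- by rewrite app_S !app_K.
- by rewrite app_K.
- by rewrite app_K.
- by rewrite app_S IHf IHs.
Qed.

Definition rec (F : dom M (tO ⇾ tO ⇾ tO)) (m n : N) : N :=
  app (app (app (const cRec) F) m) n.

Lemma rec0 F m : rec F m zero = m.
Proof. exact: model_ax (ax_rec0 (Var F) (Var m)). Qed.

Lemma recS F m n : rec F m (add n one) = app (app F n) (rec F m n).
Proof. exact: model_ax (ax_recS (Var F) (Var m) (Var n)). Qed.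

Lemma model_semiring : semi_ring_theory zero one add mul eq.
Proof.
have addC x y : add x y = add y x := model_ax (ax_addC (Var x) (Var y)).
have mulC x y : mul x y = mul y x := model_ax (ax_mulC (Var x) (Var y)).
split=> [x|||x|x|||x y z] //.
- by rewrite addC; exact: model_ax (ax_add0 (Var x)).
- by move=> x y z; exact: model_ax (ax_addA (Var x) (Var y) (Var z)).
- by rewrite mulC; exact: model_ax (ax_mul1 (Var x)).
- by rewrite mulC; exact: model_ax (ax_mul0 (Var x)).
- by move=> x y z; exact: model_ax (ax_mulA (Var x) (Var y) (Var z)).
- by rewrite ![mul _ z]mulC; exact: model_ax (ax_mulD (Var z) (Var x) (Var y)).
Qed.

Add Ring model_ring : model_semiring.

Lemma less_irr (x : N) : ~ less x x.
Proof. exact: model_ax (ax_ltirr (Var x)). Qed.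

Lemma less_trans (x y z : N) : less x y -> less y z -> less x z.
Proof. exact: model_ax (ax_lttrans (Var x) (Var y) (Var z)). Qed.

Lemma less_total (x y : N) : [\/ less x y, x = y | less y x].
Proof.
case: (model_ax (ax_lttotal (Var x) (Var y))) => [|[]];
  [exact: Or31|exact: Or32|exact: Or33].
Qed.

Lemma less_succ (x y : N) : less x (add y one) -> leq x y.
Proof. exact: model_ax (ax_discr (Var x) (Var y)). Qed.

Lemma less01 : less zero one.
Proof. exact: model_ax (@ax_lt01 (dom M)). Qed.

Lemma less_add (x y z : N) : less x y -> less (add x z) (add y z).
Proof. exact: model_ax (ax_ltadd (Var x) (Var y) (Var z)). Qed.

Lemma leq0 (x : N) : leq zero x.
Proof. exact: model_ax (ax_ge0 (Var x)). Qed.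

Lemma succ_leq (x y : N) : less x y -> leq (add x one) y.
Proof.
move=> xy; case: (less_total (add x one) y) => [|->|/less_succ]; [by left|by right|].
by case=> [/(less_trans xy)|yx]; [|rewrite yx in xy]; [move/less_irr|case/less_irr: xy].
Qed.

Definition representable τ (f : N -> dom M τ) : Prop :=
  exists s : tm (ext (dom M) tO) τ, forall n, teval (econs n self) s = f n.

Lemma rep_cst τ (d : dom M τ) : representable (fun=> d).
Proof. by exists (Var (old d)). Qed.

Lemma rep_id : representable (fun n => n).
Proof. by exists (Var new). Qed.

Lemma rep_app σ τ (f : N -> dom M (σ ⇾ τ)) (g : N -> dom M σ) :
  representable f -> representable g -> representable (fun n => app (f n) (g n)).
Proof. by move=> [s sf] [t tg]; exists (App s t) => n /=; rewrite sf tg. Qed.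

Definition qf_pred (P : N -> Prop) : Prop :=
  exists2 φ : fm (ext (dom M) tO), qf φ & forall n, feval (econs n self) φ <-> P n.

Lemma qf_eq f g : representable f -> representable g -> qf_pred (fun n => f n = g n :> N).
Proof. by move=> [s sf] [t tg]; exists (Eq s t) => // n; rewrite /= sf tg. Qed.

Lemma qf_less f g : representable f -> representable g -> qf_pred (fun n => less (f n) (g n)).
Proof. by move=> [s sf] [t tg]; exists (Lt s t) => // n; rewrite /= sf tg. Qed.

Lemma qf_imp P Q : qf_pred P -> qf_pred Q -> qf_pred (fun n => P n -> Q n).
Proof. by move=> [φ ? φP] [ψ ? ψQ]; exists (Imp φ ψ) => // n; rewrite /= φP ψQ. Qed.

Lemma qf_and P Q : qf_pred P -> qf_pred Q -> qf_pred (fun n => P n /\ Q n).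
Proof. by move=> [φ ? φP] [ψ ? ψQ]; exists (And φ ψ) => // n; rewrite /= φP ψQ. Qed.

Lemma qf_or P Q : qf_pred P -> qf_pred Q -> qf_pred (fun n => P n \/ Q n).
Proof. by move=> [φ ? φP] [ψ ? ψQ]; exists (Or φ ψ) => // n; rewrite /= φP ψQ. Qed.

(** The predicate is semantic here; the tactic [qf] finds a quantifier-free formula for it. The
    predicates used below spell out [leq] as a disjunction in order to expose their connectives. *)
Lemma model_ind (P : N -> Prop) :
  qf_pred P -> P zero -> (forall n, P n -> P (add n one)) -> forall n, P n.
Proof.
move=> [φ qfφ φP] P0 PS n; apply/φP; move: n.
apply: (model_ax (ax_ind qfφ)); split.
  by change (feval self (inst (Cst c0) φ)); rewrite feval_inst; apply/φP.
move=> n; change (feval (econs n self) φ -> feval (econs n self) (instS φ)).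
move=> /φP /PS /φP; rewrite /instS feval_fsub (_ : (fun _ _ => _) = econs (add n one) self) //.
exact: ext_funext.
Qed.

Ltac rep := solve [repeat first [exact: rep_cst | exact: rep_id | apply: rep_app]].
Ltac qf := solve [repeat first
  [apply: qf_and | apply: qf_or | apply: qf_imp | apply: qf_eq; rep | apply: qf_less; rep]].

(** * Primitive recursive arithmetic in a model *)

Definition step_fun (s : tm (ext (ext noVar tO) tO) tO) : dom M (tO ⇾ tO ⇾ tO) :=
  teval void (lam (lam s)).

Lemma step_funE s m n : app (app (step_fun s) m) n = teval (econs n (econs m void)) s.
Proof. by rewrite /step_fun !teval_lam. Qed.

Definition mpred := rec (step_fun #1) zero.
Definition mmonus m n := rec (step_fun (predN #0)) m n.
Definition mexp2 n := rec (step_fun (#0 + #0)) one n.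
Definition mparity n := rec (step_fun (monus 1 #0)) zero n.
Definition mhalf n := rec (step_fun (#0 + parity #1)) zero n.
Definition mtri n := rec (step_fun (#0 + (#1 + 1))) zero n.
Definition mtriroot n :=
  rec (step_fun (#0 + monus 1 (monus (tri (#0 + 1)) (#1 + 1)))) zero n.
Definition mpair m n := add (mtri (add m n)) m.
Definition mfst q := mmonus q (mtri (mtriroot q)).
Definition msnd q := mmonus (mtriroot q) (mfst q).
Definition mpos q := mul (mmonus one (mparity (mfst q))) (mhalf (mfst q)).
Definition mneg q := mul (mparity (mfst q)) (mhalf (add (mfst q) one)).
Definition mden q := add (msnd q) one.

Lemma mpred0 : mpred zero = zero. Proof. exact: rec0. Qed.
Lemma mpredS n : mpred (add n one) = n.
Proof. by rewrite /mpred recS step_funE. Qed.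
Lemma mmonus0 m : mmonus m zero = m. Proof. exact: rec0. Qed.
Lemma mmonusS m n : mmonus m (add n one) = mpred (mmonus m n).
Proof. by rewrite /mmonus recS step_funE. Qed.
Lemma mexp20 : mexp2 zero = one. Proof. exact: rec0. Qed.
Lemma mexp2S n : mexp2 (add n one) = add (mexp2 n) (mexp2 n).
Proof. by rewrite /mexp2 recS step_funE. Qed.
Lemma mparity0 : mparity zero = zero. Proof. exact: rec0. Qed.
Lemma mparityS n : mparity (add n one) = mmonus one (mparity n).
Proof. by rewrite /mparity recS step_funE. Qed.
Lemma mhalf0 : mhalf zero = zero. Proof. exact: rec0. Qed.
Lemma mhalfS n : mhalf (add n one) = add (mhalf n) (mparity n).
Proof. by rewrite /mhalf recS step_funE. Qed.
Lemma mtri0 : mtri zero = zero. Proof. exact: rec0. Qed.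
Lemma mtriS n : mtri (add n one) = add (mtri n) (add n one).
Proof. by rewrite /mtri recS step_funE. Qed.
Lemma mtriroot0 : mtriroot zero = zero. Proof. exact: rec0. Qed.
Lemma mtrirootS n : mtriroot (add n one) =
  add (mtriroot n) (mmonus one (mmonus (mtri (add (mtriroot n) one)) (add n one))).
Proof. by rewrite /mtriroot recS step_funE. Qed.

Lemma succ_pred n : n = zero \/ n = add (mpred n) one.
Proof.
apply: (model_ind (P := fun n => n = zero \/ n = add (mpred n) one)).
- qf.
- by left.
- by move=> {}n _; right; rewrite mpredS.
Qed.

Lemma mmonusK n m : leq m n -> add (mmonus n m) m = n.
Proof.
apply: (model_ind (P := fun m => less m n \/ m = n -> add (mmonus n m) m = n)).
- qf.
- by move=> _; rewrite mmonus0; ring.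
- move=> {}m IH h; have lt : less m n.
    have m1 : less m (add m one).
      by have := less_add m less01; rewrite [add zero m](_ : _ = m) 1?[add one m](_ : _ = add m one) //; ring.
    by case: h => [/(less_trans m1)|<-].
  have {}IH := IH (or_introl lt); rewrite mmonusS.
  (* If the difference were already 0, the induction hypothesis would give m = n, against m < n; so
     it is a successor and its predecessor is exact. *)
  case: (succ_pred (mmonus n m)) => mE.
    by case: (@less_irr n); rewrite -{1}IH mE [add zero m](_ : _ = m) //; ring.
  by rewrite -{2}IH {2}mE; ring.
Qed.

Lemma less_mul (x y z : N) : less zero z -> less x y -> less (mul x z) (mul y z).
Proof. exact: model_ax (ax_ltmul (Var x) (Var y) (Var z)). Qed.

(** Transparent, so that the operations of this semiring are convertible to those of the model. *)
Definition model_osemiring : osemiring.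
Proof.
apply: (@OSemiring N zero one add mul less model_semiring less_irr less_trans
  less_total less_add less_mul less01).
- by move=> x; case: (leq0 x) => [|<-]; [left|right].
- move=> x y /succ_leq/mmonusK <-; exists (mmonus y (add x one)); ring.
Defined.

(** * Evaluation of terms and formulas in a model *)

Section Evaluation.
Variables (V : ty -> Set) (ρ : env M V).
Implicit Types t u : tm V tO.

Lemma teval_add t u : teval ρ (t + u) = add (teval ρ t) (teval ρ u). Proof. by []. Qed.
Lemma teval_mul t u : teval ρ (t * u) = mul (teval ρ t) (teval ρ u). Proof. by []. Qed.
Lemma teval_app σ τ (f : tm V (σ ⇾ τ)) (s : tm V σ) :
  teval ρ (f · s) = app (teval ρ f) (teval ρ s).
Proof. by []. Qed.
Lemma teval_exp2 t : teval ρ (exp2 t) = mexp2 (teval ρ t). Proof. by []. Qed.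
Lemma teval_monus t u : teval ρ (monus t u) = mmonus (teval ρ t) (teval ρ u).
Proof. by []. Qed.
Lemma teval_parity t : teval ρ (parity t) = mparity (teval ρ t). Proof. by []. Qed.
Lemma teval_half t : teval ρ (half t) = mhalf (teval ρ t). Proof. by []. Qed.
Lemma teval_tri t : teval ρ (tri t) = mtri (teval ρ t). Proof. by []. Qed.
Lemma teval_triroot t : teval ρ (triroot t) = mtriroot (teval ρ t). Proof. by []. Qed.
Lemma teval_pairN t u : teval ρ (pairN t u) = mpair (teval ρ t) (teval ρ u).
Proof. by rewrite /pairN !teval_add teval_tri. Qed.
Lemma teval_fstN t : teval ρ (fstN t) = mfst (teval ρ t).
Proof. by rewrite /fstN teval_monus teval_tri teval_triroot. Qed.
Lemma teval_sndN t : teval ρ (sndN t) = msnd (teval ρ t).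
Proof. by rewrite /sndN teval_monus teval_fstN teval_triroot. Qed.
Lemma teval_pos t : teval ρ (pos t) = mpos (teval ρ t).
Proof. by rewrite /pos teval_mul teval_monus teval_half teval_parity teval_fstN. Qed.
Lemma teval_neg t : teval ρ (neg t) = mneg (teval ρ t).
Proof. by rewrite /neg teval_mul teval_half teval_parity teval_add teval_fstN. Qed.
Lemma teval_den t : teval ρ (den t) = mden (teval ρ t).
Proof. by rewrite /den teval_add teval_sndN. Qed.

End Evaluation.

Definition tevalE := (teval_twk, teval_add, teval_mul, teval_exp2, teval_monus, teval_parity, teval_half,
  teval_pairN, teval_fstN, teval_sndN, teval_pos, teval_neg, teval_den).

(** From here the prefix [m] marks the meaning in the model of a syntactic notion. That these
    readings are faithful is the content of [feval_Korg1] and [feval_NBI]. *)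
Definition mdiff_lt (q r c n : N) : Prop :=
  less (mul (mexp2 n) (add (mul (mpos q) (mden r)) (mul (mneg r) (mden q))))
    (add (mul (mexp2 n) (add (mul (mpos r) (mden q)) (mul (mneg q) (mden r))))
      (mul c (mul (mden q) (mden r)))).
Definition mdiff_le (q r c n : N) : Prop :=
  leq (mul (mexp2 n) (add (mul (mpos q) (mden r)) (mul (mneg r) (mden q))))
    (add (mul (mexp2 n) (add (mul (mpos r) (mden q)) (mul (mneg q) (mden r))))
      (mul c (mul (mden q) (mden r)))).
Definition mdiff_gt (q r c n : N) : Prop :=
  less (add (mul (mexp2 n) (add (mul (mpos r) (mden q)) (mul (mneg q) (mden r))))
      (mul c (mul (mden q) (mden r))))
    (mul (mexp2 n) (add (mul (mpos q) (mden r)) (mul (mneg r) (mden q)))).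

Definition mreal (x : N1) : Prop := forall n i : N,
  mdiff_lt (app x n) (app x (add n i)) one n /\ mdiff_lt (app x (add n i)) (app x n) one n.
Definition meqR (x y : N1) : Prop := forall n : N,
  mdiff_le (app x n) (app y n) two n /\ mdiff_le (app y n) (app x n) two n.
Definition mltR (x y : N1) : Prop := exists n : N, mdiff_gt (app y n) (app x n) two n.
Definition mzeroR : N1 := teval void zeroR.
Definition moneR : N1 := teval void oneR.
Definition min01 (x : N1) : Prop := mreal x /\ ~ mltR x mzeroR /\ ~ mltR moneR x.
Definition mmem (x : N1) (A : dom M (t1 ⇾ t1)) : Prop := mreal x /\ mltR mzeroR (app A x).
Definition mfunRR (F : dom M (t1 ⇾ t1)) : Prop :=
  (forall x, mreal x -> mreal (app F x)) /\
  (forall x y, mreal x -> mreal y -> meqR x y -> meqR (app F x) (app F y)).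
Definition mrelated (R : dom M (t1 ⇾ t1 ⇾ t1)) (x y : N1) : Prop :=
  mltR mzeroR (app (app R x) y).
Definition mfunRRR (F : dom M (t1 ⇾ t1 ⇾ t1)) : Prop :=
  (forall x y, mreal x -> mreal y -> mreal (app (app F x) y)) /\
  (forall x y z, mreal x -> mreal y -> mreal z -> meqR x y ->
    meqR (app (app F x) z) (app (app F y) z) /\ meqR (app (app F z) x) (app (app F z) y)).
Definition mfunRN (Y : dom M t2) : Prop :=
  forall x y, mreal x -> mreal y -> meqR x y -> app Y x = app Y y.
Definition minjective (Y : dom M t2) (A : dom M (t1 ⇾ t1)) : Prop :=
  forall x y, mmem x A -> mmem y A -> app Y x = app Y y -> meqR x y.
Definition mfinite (A : dom M (t1 ⇾ t1)) : Prop :=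
  exists k : N, exists Y : dom M t2, mfunRN Y /\ minjective Y A /\
    (forall x, mmem x A -> leq (app Y x) k).

Definition mKorg1 : Prop := forall (G : dom M (t1 ⇾ t1)) (R : dom M (t1 ⇾ t1 ⇾ t1))
    (E : dom M (tO ⇾ t1 ⇾ t1)),
  mfunRR G /\ ~ mfinite G /\
  (exists Y : dom M t2, mfunRN Y /\ minjective Y G /\
    (forall n, exists x, mmem x G /\ app Y x = n)) /\
  mfunRRR R /\
  (forall x y, mreal x -> mreal y -> mrelated R x y -> mrelated R y x) /\
  ((forall n, leq one n ->
      mfunRR (app E n) /\ (exists x, mmem x (app E n)) /\ mfinite (app E n)) /\
   (forall x, (mmem x G -> exists n, leq one n /\ mmem x (app E n)) /\
     ((exists n, leq one n /\ mmem x (app E n)) -> mmem x G))) /\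
  (forall n, leq one n -> forall x, mmem x (app E (add n one)) ->
    exists y, mmem y (app E n) /\ mrelated R x y) ->
  exists a : dom M (tO ⇾ t1), forall n, leq one n ->
    mmem (app a n) (app E n) /\ mrelated R (app a n) (app a (add n one)).

Definition mNBI : Prop := forall Y : dom M t2,
  (forall x y, min01 x -> min01 y -> meqR x y -> app Y x = app Y y) ->
  (exists x y, min01 x /\ min01 y /\ ~ meqR x y /\ app Y x = app Y y) \/
  (exists n : N, forall x, min01 x -> ~ app Y x = n).

Section FormulaEvaluation.
Variables (V : ty -> Set) (ρ : env M V).

(** Evaluation is stated as equality of propositions, one connective at a time, so that it can be
    carried out by rewriting under binders while the arithmetic terms stay folded. *)
Lemma feval_Imp (φ ψ : fm V) (P Q : Prop) :
  feval ρ φ = P -> feval ρ ψ = Q -> feval ρ (φ ⟶ ψ) = (P -> Q).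
Proof. by move=> <- <-. Qed.
Lemma feval_And (φ ψ : fm V) (P Q : Prop) :
  feval ρ φ = P -> feval ρ ψ = Q -> feval ρ (φ ∧ ψ) = (P /\ Q).
Proof. by move=> <- <-. Qed.
Lemma feval_Or (φ ψ : fm V) (P Q : Prop) :
  feval ρ φ = P -> feval ρ ψ = Q -> feval ρ (φ ∨ ψ) = (P \/ Q).
Proof. by move=> <- <-. Qed.
Lemma feval_Not (φ : fm V) (P : Prop) : feval ρ φ = P -> feval ρ (¬ φ) = ~ P.
Proof. by move=> <-. Qed.
Lemma feval_All σ (φ : fm (ext V σ)) (P : dom M σ -> Prop) :
  (forall d, feval (econs d ρ) φ = P d) -> feval ρ (All σ φ) = forall d, P d.
Proof. exact: eq_forall. Qed.
Lemma feval_Ex σ (φ : fm (ext V σ)) (P : dom M σ -> Prop) :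
  (forall d, feval (econs d ρ) φ = P d) -> feval ρ (Ex σ φ) = exists d, P d.
Proof. exact: eq_exists. Qed.
Lemma feval_Eq (s t : tm V tO) : feval ρ (s ≐ t) = (teval ρ s = teval ρ t).
Proof. by []. Qed.
Lemma feval_Lt (s t : tm V tO) : feval ρ (s ≺ t) = less (teval ρ s) (teval ρ t).
Proof. by []. Qed.
Lemma feval_Le (s t : tm V tO) : feval ρ (s ≼ t) = leq (teval ρ s) (teval ρ t).
Proof. by []. Qed.

Lemma feval_diff_lt (q r c n : tm V tO) : feval ρ (diff_lt q r c n) =
  mdiff_lt (teval ρ q) (teval ρ r) (teval ρ c) (teval ρ n).
Proof. by rewrite /diff_lt feval_Lt !tevalE. Qed.

Lemma feval_diff_gt (q r c n : tm V tO) : feval ρ (diff_gt q r c n) =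
  mdiff_gt (teval ρ q) (teval ρ r) (teval ρ c) (teval ρ n).
Proof. by rewrite /diff_gt feval_Lt !tevalE. Qed.

Lemma feval_diff_le (q r c n : tm V tO) : feval ρ (diff_le q r c n) =
  mdiff_le (teval ρ q) (teval ρ r) (teval ρ c) (teval ρ n).
Proof. by rewrite /diff_le feval_Le !tevalE. Qed.

End FormulaEvaluation.

Ltac fevalE := repeat first
  [apply: feval_All => ? | apply: feval_Ex => ? | apply: feval_And].

Lemma feval_real V (ρ : env M V) x : feval ρ (real x) = mreal (teval ρ x).
Proof. by rewrite /real /mreal; fevalE; rewrite feval_diff_lt !teval_app !tevalE. Qed.

Lemma feval_eqR V (ρ : env M V) x y : feval ρ (eqR x y) = meqR (teval ρ x) (teval ρ y).
Proof. by rewrite /eqR /meqR; fevalE; rewrite feval_diff_le !teval_app !tevalE. Qed.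

Lemma feval_ltR V (ρ : env M V) x y : feval ρ (ltR x y) = mltR (teval ρ x) (teval ρ y).
Proof. by rewrite /ltR /mltR; fevalE; rewrite feval_diff_gt !teval_app !tevalE. Qed.

Lemma teval_lam_closed V (ρ : env M V) (s : forall W, tm (ext W tO) tO) :
  (forall W W' (ρ : env M W) (ρ' : env M W') d,
     teval (econs d ρ) (s W) = teval (econs d ρ') (s W')) ->
  teval ρ (lam (s V)) = teval void (lam (s noVar)).
Proof. by move=> h; apply: Mext => d; rewrite !teval_lam; apply: h. Qed.

Lemma teval_zeroR V (ρ : env M V) : teval ρ zeroR = mzeroR.
Proof.
by apply: (teval_lam_closed ρ (s := fun W => pairN 0 0)) => *; rewrite !tevalE.
Qed.

Lemma teval_oneR V (ρ : env M V) : teval ρ oneR = moneR.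
Proof.
by apply: (teval_lam_closed ρ (s := fun W => pairN (num 2) 0)) => *; rewrite !tevalE.
Qed.

Lemma feval_in01 V (ρ : env M V) x : feval ρ (in01 x) = min01 (teval ρ x).
Proof.
apply: feval_And; first exact: feval_real.
by apply: feval_And; apply: feval_Not; rewrite feval_ltR ?teval_zeroR ?teval_oneR.
Qed.

Lemma feval_mem V (ρ : env M V) x A : feval ρ (mem x A) = mmem (teval ρ x) (teval ρ A).
Proof. by apply: feval_And; rewrite ?feval_real ?feval_ltR ?teval_zeroR. Qed.

Lemma feval_related V (ρ : env M V) R x y :
  feval ρ (related R x y) = mrelated (teval ρ R) (teval ρ x) (teval ρ y).
Proof. by rewrite /related feval_ltR teval_zeroR. Qed.

Lemma feval_funRR V (ρ : env M V) F : feval ρ (funRR F) = mfunRR (teval ρ F).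
Proof.
apply: feval_And.
  apply: feval_All => x; apply: feval_Imp; first exact: feval_real.
  by rewrite feval_real teval_app !tevalE.
apply: feval_All => x; apply: feval_All => y.
do 3 (apply: feval_Imp; first by rewrite ?feval_real ?feval_eqR).
by rewrite feval_eqR !teval_app !tevalE.
Qed.

Lemma feval_funRRR V (ρ : env M V) F : feval ρ (funRRR F) = mfunRRR (teval ρ F).
Proof.
apply: feval_And.
  apply: feval_All => x; apply: feval_All => y.
  do 2 (apply: feval_Imp; first by rewrite feval_real).
  by rewrite feval_real !teval_app !tevalE.
apply: feval_All => x; apply: feval_All => y; apply: feval_All => z.
do 4 (apply: feval_Imp; first by rewrite ?feval_real ?feval_eqR).
by apply: feval_And; rewrite feval_eqR !teval_app !tevalE.
Qed.

Lemma feval_funRN V (ρ : env M V) Y : feval ρ (funRN Y) = mfunRN (teval ρ Y).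
Proof.
apply: feval_All => x; apply: feval_All => y.
do 3 (apply: feval_Imp; first by rewrite ?feval_real ?feval_eqR).
by rewrite feval_Eq !teval_app !tevalE.
Qed.

Lemma feval_injective_on V (ρ : env M V) Y A :
  feval ρ (injective_on Y A) = minjective (teval ρ Y) (teval ρ A).
Proof.
apply: feval_All => x; apply: feval_All => y.
do 2 (apply: feval_Imp; first by rewrite feval_mem !tevalE).
by apply: feval_Imp; rewrite ?feval_eqR ?feval_Eq ?teval_app ?tevalE.
Qed.

Lemma feval_finite V (ρ : env M V) A : feval ρ (finite A) = mfinite (teval ρ A).
Proof.
apply: feval_Ex => k; apply: feval_Ex => Y.
apply: feval_And; first by rewrite feval_funRN.
apply: feval_And; first by rewrite feval_injective_on !tevalE.
by apply: feval_All => x; apply: feval_Imp; rewrite ?feval_mem ?feval_Le ?teval_app ?tevalE.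
Qed.

Lemma feval_strongly_countable V (ρ : env M V) A : feval ρ (strongly_countable A) =
  exists Y : dom M t2, mfunRN Y /\ minjective Y (teval ρ A) /\
    (forall n, exists x, mmem x (teval ρ A) /\ app Y x = n).
Proof.
apply: feval_Ex => Y.
apply: feval_And; first by rewrite feval_funRN.
apply: feval_And; first by rewrite feval_injective_on !tevalE.
apply: feval_All => n; apply: feval_Ex => x.
by apply: feval_And; rewrite ?feval_mem ?feval_Eq ?teval_app ?tevalE.
Qed.

Lemma feval_symmetric V (ρ : env M V) R : feval ρ (symmetric R) =
  forall x y, mreal x -> mreal y -> mrelated (teval ρ R) x y -> mrelated (teval ρ R) y x.
Proof.
apply: feval_All => x; apply: feval_All => y.
do 2 (apply: feval_Imp; first by rewrite feval_real).
by apply: feval_Imp; rewrite feval_related !tevalE.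
Qed.

Lemma feval_finite_exhaustion V (ρ : env M V) G E : feval ρ (finite_exhaustion G E) =
  ((forall n, leq one n -> mfunRR (app (teval ρ E) n) /\
     (exists x, mmem x (app (teval ρ E) n)) /\ mfinite (app (teval ρ E) n)) /\
   (forall x, (mmem x (teval ρ G) -> exists n, leq one n /\ mmem x (app (teval ρ E) n)) /\
     ((exists n, leq one n /\ mmem x (app (teval ρ E) n)) -> mmem x (teval ρ G)))).
Proof.
have memG V' (ρ' : env M V') x E' : feval ρ' (∃[tO] 1 ≼ #0 ∧ mem (x↑)%tm (E'↑ · #0)%tm) =
    exists n, leq one n /\ mmem (teval ρ' x) (app (teval ρ' E') n).
  by apply: feval_Ex => n; apply: feval_And; rewrite ?feval_Le ?feval_mem ?teval_app ?tevalE.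
apply: feval_And.
  apply: feval_All => n; apply: feval_Imp; first by rewrite feval_Le.
  apply: feval_And; first by rewrite feval_funRR teval_app !tevalE.
  apply: feval_And; last by rewrite feval_finite teval_app !tevalE.
  by apply: feval_Ex => x; rewrite feval_mem !teval_app !tevalE.
apply: feval_All => x; apply: feval_And; apply: feval_Imp.
- by rewrite feval_mem !tevalE.
- by rewrite (memG _ _ #0%tm (E↑)%tm) tevalE.
- by rewrite (memG _ _ #0%tm (E↑)%tm) tevalE.
- by rewrite feval_mem !tevalE.
Qed.

Lemma feval_linked V (ρ : env M V) R E : feval ρ (linked R E) =
  forall n, leq one n -> forall x, mmem x (app (teval ρ E) (add n one)) ->
    exists y, mmem y (app (teval ρ E) n) /\ mrelated (teval ρ R) x y.
Proof.
apply: feval_All => n; apply: feval_Imp; first by rewrite feval_Le.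
apply: feval_All => x; apply: feval_Imp; first by rewrite feval_mem !teval_app !tevalE.
apply: feval_Ex => y; apply: feval_And; last by rewrite feval_related !tevalE.
by rewrite feval_mem !teval_app !tevalE.
Qed.

Lemma feval_Korg1 : feval void Korg1 = mKorg1.
Proof.
apply: feval_All => G; apply: feval_All => R; apply: feval_All => E.
apply: feval_Imp.
  apply: feval_And; first by rewrite feval_funRR.
  apply: feval_And; first by apply: feval_Not; rewrite feval_finite.
  apply: feval_And; first by rewrite feval_strongly_countable.
  apply: feval_And; first by rewrite feval_funRRR.
  apply: feval_And; first by rewrite feval_symmetric.
  by apply: feval_And; rewrite ?feval_finite_exhaustion ?feval_linked.
apply: feval_Ex => a; apply: feval_All => n; apply: feval_Imp; first by rewrite feval_Le.
by apply: feval_And; rewrite ?feval_mem ?feval_related !teval_app !tevalE.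
Qed.

Lemma feval_NBI : feval void NBI = mNBI.
Proof.
apply: feval_All => Y; apply: feval_Imp.
  apply: feval_All => x; apply: feval_All => y.
  do 3 (apply: feval_Imp; first by rewrite ?feval_in01 ?feval_eqR).
  by rewrite feval_Eq !teval_app !tevalE.
apply: feval_Or.
  apply: feval_Ex => x; apply: feval_Ex => y.
  do 2 (apply: feval_And; first by rewrite ?feval_in01).
  by apply: feval_And; [apply: feval_Not; rewrite feval_eqR|rewrite feval_Eq !teval_app].
apply: feval_Ex => n; apply: feval_All => x; apply: feval_Imp; first by rewrite feval_in01.
by apply: feval_Not; rewrite feval_Eq !teval_app.
Qed.

(* From here on [ring] is MathComp's, for the field K; before, it is Stdlib's, for semirings. *)
Import ring lra.
Local Open Scope ring_scope.

(** * Arithmetic of the model inside an ordered field *)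

Variables (K : realFieldType) (ι : N -> K).
Hypotheses (ι0 : ι zero = 0) (ι1 : ι one = 1)
  (ιD : forall x y, ι (add x y) = ι x + ι y) (ιM : forall x y, ι (mul x y) = ι x * ι y)
  (ι_less : forall x y, less x y <-> ι x < ι y)
  (ι_arch : forall k : K, 0 < k -> exists n, 1 <= ι n * k).

Lemma ι_inj : injective ι.
Proof.
move=> x y xy; case: (less_total x y) => // /ι_less; by rewrite xy ltxx.
Qed.

Lemma ι_leq x y : leq x y <-> ι x <= ι y.
Proof.
rewrite le_eqVlt; split=> [[/ι_less ->|->]|/orP[/eqP/ι_inj ->|/ι_less]].
- by rewrite orbT.
- by rewrite eqxx.
- by right.
- by left.
Qed.

Lemma ι_ge0 x : 0 <= ι x.
Proof. by rewrite -ι0; apply/ι_leq/leq0. Qed.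

Lemma ι_lt_succ x y : ι x < ι y -> ι x + 1 <= ι y.
Proof. by move/ι_less/succ_leq/ι_leq; rewrite ιD ι1. Qed.

Lemma ι_two : ι two = 2.
Proof. by rewrite /two !ιD ι0 ι1; lra. Qed.

Definition ιE := (ιD, ιM, ι0, ι1, ι_two).

Lemma monus_eq0 m n : leq m n -> mmonus m n = zero.
Proof.
apply: (model_ind (P := fun n => less m n \/ m = n -> mmonus m n = zero)).
- qf.
- case=> [/ι_less|->]; last exact: mmonus0.
  by rewrite ι0 => /(le_lt_trans (ι_ge0 m)); rewrite ltxx.
- move=> {}n IH /ι_leq; rewrite le_eqVlt => /orP[/eqP/ι_inj mE|/ι_less/less_succ/IH h].
    have /mmonusK/(congr1 ι) : leq (add n one) m by right.
    by rewrite {2}mE ιD => h; apply: ι_inj; rewrite ι0; lra.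
  by rewrite mmonusS h mpred0.
Qed.

(** Truncated subtraction as two linear cases, the form that [lra] can use. *)
Lemma monusP m n : (ι m <= ι n /\ ι (mmonus m n) = 0) \/
  (ι n <= ι m /\ ι (mmonus m n) = ι m - ι n).
Proof.
case: (leP (ι m) (ι n)) => [mn|/ltW nm]; [left|right]; split=> //.
  by rewrite monus_eq0 ?ι0 //; apply/ι_leq.
by have /ι_leq/mmonusK/(congr1 ι) := nm; rewrite ιD => h; lra.
Qed.

Lemma parity01 n : mparity n = zero \/ mparity n = one.
Proof.
apply: (model_ind (P := fun n => mparity n = zero \/ mparity n = one)).
- qf.
- by left; exact: mparity0.
- move=> {}n [h|h]; rewrite mparityS h; [right|left]; apply: ι_inj;
    case: (monusP one (mparity n)); rewrite h !ιE; lra.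
Qed.

Lemma half_parity n : ι n = 2 * ι (mhalf n) + ι (mparity n).
Proof.
suff {1}-> : n = add (add (mhalf n) (mhalf n)) (mparity n) by rewrite !ιE; ring.
apply: (model_ind (P := fun n => n = add (add (mhalf n) (mhalf n)) (mparity n))).
- qf.
- by rewrite mhalf0 mparity0; apply: ι_inj; rewrite !ιE; ring.
- move=> {}n /(congr1 ι) IH; rewrite mhalfS mparityS; apply: ι_inj.
  move: IH; case: (monusP one (mparity n)); case: (parity01 n) => ->; rewrite !ιE; lra.
Qed.

(** If the parity of 2a were 1, then a and the half of 2a would differ by 1/2, whereas distinct
    numbers differ by at least 1. *)
Lemma parity_half_double a : mparity (add a a) = zero /\ mhalf (add a a) = a.
Proof.
have h := half_parity (add a a).
case: (parity01 (add a a)) => p; rewrite p !ιE in h.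
  by split=> //; apply: ι_inj; lra.
by clear p; exfalso; case: (ltgtP (ι a) (ι (mhalf (add a a)))) => [/ι_lt_succ|/ι_lt_succ|]; lra.
Qed.

Lemma ι_tri n : 2 * ι (mtri n) = ι n * (ι n + 1).
Proof.
have h : add (mtri n) (mtri n) = mul n (add n one).
  apply: (model_ind (P := fun n => add (mtri n) (mtri n) = mul n (add n one))).
  - qf.
  - by rewrite mtri0; apply: ι_inj; rewrite !ιE; ring.
  - move=> {}n /(congr1 ι) IH; rewrite mtriS; apply: ι_inj.
    by move: IH; rewrite !ιE => IH; lra.
by move: (congr1 ι h); rewrite !ιE => <-; ring.
Qed.

Lemma triroot_bounds n :
  ι (mtri (mtriroot n)) <= ι n < ι (mtri (add (mtriroot n) one)).
Proof.
suff [/ι_leq -> /ι_less ->] : leq (mtri (mtriroot n)) n /\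
    less n (mtri (add (mtriroot n) one)) by [].
apply: (model_ind (P := fun n => (less (mtri (mtriroot n)) n \/ mtri (mtriroot n) = n) /\
    less n (mtri (add (mtriroot n) one)))).
- qf.
- rewrite mtriroot0 mtri0; split; first by right.
  by apply/ι_less; have := ι_tri (add zero one); rewrite !ιE; lra.
- move=> {}n [/ι_leq h1 /ι_less/ι_lt_succ h2].
  rewrite -/(leq _ _) ι_leq ι_less mtrirootS.
  set w := mtriroot n in h1 h2 *; set u := add w one in h2 *.
  have [[t1 t2] t3] := (ι_tri w, ι_tri u, ι_tri (add u one)).
  have w0 := ι_ge0 w; have uE : ι u = ι w + 1 by rewrite ιD ι1.
  rewrite uE in t2; rewrite (ιD u) ι1 uE in t3.
  (* The root moves up exactly when the next triangular number is at most n + 1; the nested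
     truncated subtraction is the 0/1 value of this test. *)
  have [le|/ι_lt_succ gt] := leP (ι (mtri u)) (ι (add n one)).
    have -> : mmonus one (mmonus (mtri u) (add n one)) = one.
      by rewrite (_ : mmonus (mtri u) _ = zero) ?mmonus0 //; apply/monus_eq0/ι_leq.
    by rewrite -/u; move: le; rewrite !ιE; lra.
  have -> : mmonus one (mmonus (mtri u) (add n one)) = zero.
    apply: monus_eq0; apply/ι_leq; move: (gt).
    by case: (monusP (mtri u) (add n one)) => -[+ ->]; rewrite !ιE; lra.
  have -> : add w zero = w by apply: ι_inj; rewrite !ιE addr0.
  by rewrite -/u; move: gt; rewrite !ιE; lra.
Qed.

(** The code lies in the interval from tri(m + n) up to tri(m + n + 1). Such intervals are disjoint
    for distinct roots, so the bounds on the triangular root force it to be m + n. *)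
Lemma mfst_pair m n : mfst (mpair m n) = m /\ mtriroot (mpair m n) = add m n.
Proof.
have [m0 n0] := (ι_ge0 m, ι_ge0 n).
have t := ι_tri (add m n); have := triroot_bounds (mpair m n).
set w := mtriroot _; have w0 := ι_ge0 w.
have [t1 t2] := (ι_tri w, ι_tri (add w one)); rewrite /mpair !ιE in t t1 t2 *.
move=> /andP[b1 b2]; have wE : w = add m n.
  apply: ι_inj; rewrite ιD; case: (ltgtP (ι w) (ι m + ι n)) => //.
    by rewrite -ιD => /ι_lt_succ; rewrite ιD; nra.
  by rewrite -ιD => /ι_lt_succ; rewrite ιD; nra.
split=> //; apply: ι_inj; rewrite /mfst -/w wE /mpair.
by case: (monusP (add (mtri (add m n)) m) (mtri (add m n))) => -[]; rewrite !ιE; lra.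
Qed.

Lemma msnd_pair m n : msnd (mpair m n) = n.
Proof.
have [m0 n0] := (ι_ge0 m, ι_ge0 n).
rewrite /msnd; have [-> ->] := mfst_pair m n; apply: ι_inj.
by case: (monusP (add m n) m) => -[]; rewrite !ιE; lra.
Qed.

Lemma ι_succ_gt0 n : 0 < ι n + 1.
Proof. by have := ι_ge0 n; lra. Qed.

Lemma den_gt0 q : 0 < ι (mden q).
Proof. by rewrite /mden !ιE ι_succ_gt0. Qed.

Lemma pos_neg q : mpos q = zero \/ mneg q = zero.
Proof.
rewrite /mpos /mneg; case: (parity01 (mfst q)) => ->; [right|left]; apply: ι_inj.
  by rewrite !ιE mul0r.
by rewrite !ιE monus_eq0 ?ι0 ?mul0r //; right.
Qed.

(* The number [mcode a b] codes the nonnegative rational a / (b + 1). *)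
Definition mcode a b : N := mpair (add a a) b.

Lemma mpos_code a b : mpos (mcode a b) = a.
Proof.
rewrite /mpos /mcode; have [-> _] := mfst_pair (add a a) b.
have [-> ->] := parity_half_double a; rewrite mmonus0; apply: ι_inj.
by rewrite !ιE mul1r.
Qed.

Lemma mneg_code a b : mneg (mcode a b) = zero.
Proof.
rewrite /mneg /mcode; have [-> _] := mfst_pair (add a a) b.
have [-> _] := parity_half_double a; apply: ι_inj.
by rewrite !ιE mul0r.
Qed.

Lemma mden_code a b : mden (mcode a b) = add b one.
Proof. by rewrite /mden /mcode msnd_pair. Qed.

Definition val q : K := (ι (mpos q) - ι (mneg q)) / ι (mden q).

Lemma val_code a b : val (mcode a b) = ι a / (ι b + 1).
Proof. by rewrite /val mpos_code mneg_code mden_code !ιE subr0. Qed.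

Lemma exp2_gt0 n : 0 < ι (mexp2 n).
Proof.
rewrite -ι0; apply/ι_less.
apply: (model_ind (P := fun n => less zero (mexp2 n))).
- qf.
- by rewrite mexp20; exact: less01.
- by move=> {}n /ι_less IH; apply/ι_less; rewrite mexp2S; move: IH; rewrite !ιE; lra.
Qed.

Lemma exp2S n : ι (mexp2 (add n one)) = 2 * ι (mexp2 n).
Proof. by rewrite mexp2S ιD; ring. Qed.

Lemma exp2D m n : ι (mexp2 (add m n)) = ι (mexp2 m) * ι (mexp2 n).
Proof.
rewrite -ιM; congr ι.
apply: (model_ind (P := fun n => mexp2 (add m n) = mul (mexp2 m) (mexp2 n))).
- qf.
- apply: ι_inj; rewrite mexp20 !ιE mulr1; congr (ι (mexp2 _)); apply: ι_inj.
  by rewrite !ιE addr0.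
- move=> {}n /(congr1 ι) IH; apply: ι_inj; rewrite ιM.
  have -> : add m (add n one) = add (add m n) one by apply: ι_inj; rewrite !ιE addrA.
  by rewrite !exp2S IH ιM; ring.
Qed.

Lemma exp2_gt n : ι n + 1 <= ι (mexp2 n).
Proof.
rewrite -ι1 -ιD; apply/ι_leq.
apply: (model_ind (P := fun n => less (add n one) (mexp2 n) \/ add n one = mexp2 n)).
- qf.
- by apply/ι_leq; rewrite mexp20 !ιE add0r.
- move=> {}n /ι_leq IH; apply/ι_leq; rewrite mexp2S; move: IH.
  by have := ι_ge0 n; rewrite !ιE; lra.
Qed.

Lemma exp2_mono m n : ι m <= ι n -> ι (mexp2 m) <= ι (mexp2 n).
Proof.
move=> /ι_leq/mmonusK <-; rewrite exp2D ler_peMl ?(ltW (exp2_gt0 _)) //.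
by have := exp2_gt (mmonus n m); have := ι_ge0 (mmonus n m); lra.
Qed.

(** A common denominator: the comparison of coded rationals becomes the sign of one numerator, which
    is the difference of the two sides in the syntactic definitions. *)
Lemma diff_frac (E P M' D P1 M1 D1 c : K) : 0 < E -> 0 < D -> 0 < D1 ->
  c / E - ((P - M') / D - (P1 - M1) / D1) =
  (E * (P1 * D + M' * D1) + c * (D * D1) - E * (P * D1 + M1 * D)) / (E * D * D1).
Proof.
move=> E0 D0 D10; field.
by rewrite !lt0r_neq0.
Qed.

Lemma diff_ltE q r c n : mdiff_lt q r c n <-> val q - val r < ι c / ι (mexp2 n).
Proof.
rewrite /mdiff_lt ι_less -subr_gt0 -[X in _ <-> is_true X]subr_gt0 /val.
rewrite diff_frac ?exp2_gt0 ?den_gt0 // !ιE pmulr_lgt0 //.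
by rewrite invr_gt0; do !apply: mulr_gt0; rewrite ?exp2_gt0 ?ι_succ_gt0.
Qed.

Lemma diff_leE q r c n : mdiff_le q r c n <-> val q - val r <= ι c / ι (mexp2 n).
Proof.
rewrite /mdiff_le ι_leq -subr_ge0 -[X in _ <-> is_true X]subr_ge0 /val.
rewrite diff_frac ?exp2_gt0 ?den_gt0 // !ιE pmulr_lge0 //.
by rewrite invr_gt0; do !apply: mulr_gt0; rewrite ?exp2_gt0 ?ι_succ_gt0.
Qed.

Lemma diff_gtE q r c n : mdiff_gt q r c n <-> ι c / ι (mexp2 n) < val q - val r.
Proof.
rewrite /mdiff_gt ι_less -subr_lt0 -[X in _ <-> is_true X]subr_lt0 /val.
rewrite diff_frac ?exp2_gt0 ?den_gt0 // !ιE pmulr_llt0 //.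
by rewrite invr_gt0; do !apply: mulr_gt0; rewrite ?exp2_gt0 ?ι_succ_gt0.
Qed.

(** * Reals in a model *)

Notation "x ⟨ n ⟩" := (val (app x n)) (at level 2, left associativity, format "x ⟨ n ⟩").
Notation e n := (ι (mexp2 n)).

Lemma exp2_neq0 n : e n != 0.
Proof. exact: lt0r_neq0 (exp2_gt0 n). Qed.

Lemma leq_add_sub m n : ι m <= ι n -> exists i, n = add m i.
Proof.
move=> /ι_leq/mmonusK <-; exists (mmonus n m); apply: ι_inj.
by rewrite !ιE addrC.
Qed.

Lemma realP x : mreal x <-> forall m n, ι m <= ι n -> `|x⟨m⟩ - x⟨n⟩| < 1 / e m.
Proof.
split=> [xr m n /leq_add_sub [i ->]|xr n i].
  by have [/diff_ltE h1 /diff_ltE h2] := xr m i; rewrite !ι1 in h1 h2; rewrite ltr_norml; lra.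
have /xr : ι n <= ι (add n i) by have := ι_ge0 i; rewrite ιD; lra.
by rewrite !diff_ltE !ι1 ltr_norml => /andP[? ?]; lra.
Qed.

Lemma eqRP x y : meqR x y <-> forall n, `|x⟨n⟩ - y⟨n⟩| <= 2 / e n.
Proof.
split=> h n; have := h n; rewrite !diff_leE !ι_two ler_norml.
  by case=> ? ?; lra.
by case/andP=> ? ?; lra.
Qed.

Lemma ltRP x y : mltR x y <-> exists n, 2 / e n < y⟨n⟩ - x⟨n⟩.
Proof. by split=> -[n]; rewrite ?diff_gtE ?ι_two => h; exists n; rewrite ?diff_gtE ?ι_two. Qed.

(** For positive C, take k with k δ >= C; then 2^m >= m + 1 > k for every m from k on. *)
Lemma exp2_arch (C δ : K) : 0 < δ -> exists k, forall m, ι k <= ι m -> C / e m < δ.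
Proof.
move=> δ0; have [C0|C0] := leP C 0.
  exists zero => m _; apply: le_lt_trans δ0.
  by rewrite pmulr_lle0 // invr_gt0 exp2_gt0.
have [k kP] := ι_arch (divr_gt0 δ0 C0); exists k => m km.
rewrite ltr_pdivrMr ?exp2_gt0 //; have := exp2_gt m.
move: kP; rewrite mulrA ler_pdivlMr // mul1r => kP em.
by apply: le_lt_trans kP _; rewrite mulrC ltr_pM2l //; lra.
Qed.

Lemma ler_exp2_eq0 (a : K) : (forall n, `|a| <= 2 / e n) -> a = 0.
Proof.
move=> h; apply/eqP; rewrite -normr_eq0 eq_le normr_ge0 andbT leNgt; apply/negP => a0.
by have [k /(_ k (lexx _))] := exp2_arch 2 a0; rewrite ltNge h.
Qed.

(** Passing through a far index m bounds the difference at n by 2 / 2^n + C / 2^m, and the last term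
    falls below any excess over 2 / 2^n. Thus the constant and the initial indices do not matter. *)
Lemma eqR_large x y (C : K) k : mreal x -> mreal y ->
  (forall n, ι k <= ι n -> `|x⟨n⟩ - y⟨n⟩| <= C / e n) -> meqR x y.
Proof.
move=> /realP xr /realP yr h; apply/eqRP => n; rewrite leNgt; apply/negP => gt.
move: gt; rewrite -subr_gt0 => gt; have [l lP] := exp2_arch C gt.
pose m := add (add n k) l.
have [n0 [k0 l0]] := (ι_ge0 n, (ι_ge0 k, ι_ge0 l)).
have nm : ι n <= ι m by rewrite !ιD; lra.
have km : ι k <= ι m by rewrite !ιD; lra.
have lm : ι l <= ι m by rewrite !ιD; lra.
have := lP m lm; have := h m km; have := xr n m nm; have := yr n m nm.
have t1 := ler_distD x⟨m⟩ x⟨n⟩ y⟨n⟩; have t2 := ler_distD y⟨m⟩ x⟨m⟩ y⟨n⟩.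
by rewrite (distrC y⟨m⟩) in t2; lra.
Qed.

Lemma eqR_refl x : meqR x x.
Proof. by apply/eqRP => n; rewrite subrr normr0 divr_ge0 // ltW ?exp2_gt0. Qed.

Lemma eqR_sym x y : meqR x y -> meqR y x.
Proof. by move=> /eqRP h; apply/eqRP => n; rewrite distrC. Qed.

Lemma eqR_trans x y z : mreal x -> mreal z -> meqR x y -> meqR y z -> meqR x z.
Proof.
move=> xr zr /eqRP xy /eqRP yz; apply: (eqR_large (C := 4) (k := zero)) => // n _.
have := xy n; have := yz n; have := ler_distD y⟨n⟩ x⟨n⟩ z⟨n⟩.
have -> : 4 / e n = 2 / e n + 2 / e n by rewrite -mulrDl; congr (_ / _); ring.
lra.
Qed.

Definition mcomp (F : N1) : dom M (t1 ⇾ t1) :=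
  app (const (cS tO tO tO)) (app (const (cK t1 tO)) F).

Lemma mcompE F x n : app (app (mcomp F) x) n = app F (app x n).
Proof. by rewrite /mcomp app_S app_K. Qed.

(** With Lipschitz constant 1, termwise application keeps the rate of convergence, so reals are
    mapped without changing indices. *)
Definition lipschitz (F : N1) := forall q r, `|F⟨q⟩ - F⟨r⟩| <= `|val q - val r|.

Lemma lipschitz_real F x : lipschitz F -> mreal x -> mreal (app (mcomp F) x).
Proof.
move=> lF /realP xr; apply/realP => m n mn; rewrite !mcompE.
exact: le_lt_trans (lF _ _) (xr _ _ mn).
Qed.

Lemma lipschitz_eqR F x y : lipschitz F -> meqR x y ->
  meqR (app (mcomp F) x) (app (mcomp F) y).
Proof.
move=> lF /eqRP xy; apply/eqRP => n; rewrite !mcompE.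
exact: le_trans (lF _ _) (xy _).
Qed.

(** * Projection to the unit interval and distance from it *)

Definition clampK (v : K) : K := if v <= 0 then 0 else if 1 <= v then 1 else v.
Definition distK (v : K) : K := if v <= 0 then - v else if 1 <= v then v - 1 else 0.

(** The twofold truncated subtraction is the minimum of numerator and denominator; the denominator
    is kept, and a negative rational has positive part 0. *)
Definition clampT V (q : tm V tO) : tm V tO :=
  (let m := monus (pos q) (monus (pos q) (den q)) in pairN (m + m) (sndN q))%tm.
(** At most one of the two summands is nonzero: the first measures how far the rational lies below
    0, the second how far above 1. *)
Definition distT V (q : tm V tO) : tm V tO :=
  (let m := (neg q + monus (pos q) (den q))%tm in pairN (m + m) (sndN q))%tm.

Definition clampN : N1 := teval void (lam (clampT #0%tm)).
Definition distN : N1 := teval void (lam (distT #0%tm)).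

Lemma clampNE q :
  app clampN q = mcode (mmonus (mpos q) (mmonus (mpos q) (mden q))) (msnd q).
Proof. by rewrite teval_lam /clampT !tevalE. Qed.

Lemma distNE q :
  app distN q = mcode (add (mneg q) (mmonus (mpos q) (mden q))) (msnd q).
Proof. by rewrite teval_lam /distT !tevalE. Qed.

Lemma ι_min m n : ι (mmonus m (mmonus m n)) = if ι m <= ι n then ι m else ι n.
Proof.
have [m0 n0] := (ι_ge0 m, ι_ge0 n).
by case: (monusP m (mmonus m n)) => -[]; case: (monusP m n) => -[? ->] ? ->;
  case: ifP => /negP; lra.
Qed.

Lemma ι_monus m n : ι (mmonus m n) = if ι m <= ι n then 0 else ι m - ι n.
Proof. by case: (monusP m n) => -[? ->]; case: ifP => /negP; lra. Qed.

Lemma val_cases q : exists a : K, 0 <= a /\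
  ((ι (mneg q) = 0 /\ ι (mpos q) = a * ι (mden q) /\ val q = a) \/
   (ι (mpos q) = 0 /\ ι (mneg q) = a * ι (mden q) /\ val q = - a)).
Proof.
have d0 := den_gt0 q; rewrite /val; case: (pos_neg q) => ->; rewrite !ι0.
  exists (ι (mneg q) / ι (mden q)); rewrite divr_ge0 ?ι_ge0 //; split=> //; right.
  by rewrite divfK ?lt0r_neq0 // sub0r mulNr.
exists (ι (mpos q) / ι (mden q)); rewrite divr_ge0 ?ι_ge0 //; split=> //; left.
by rewrite divfK ?lt0r_neq0 // subr0.
Qed.

Lemma clampN_val q : clampN⟨q⟩ = clampK (val q).
Proof.
rewrite clampNE val_code ι_min (_ : ι (msnd q) + 1 = ι (mden q)); last first.
  by rewrite /mden !ιE.
have d0 := den_gt0 q; have dn := lt0r_neq0 d0; rewrite /clampK.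
have [a [a0 [[_ [-> ->]]|[-> [_ ->]]]]] := val_cases q.
  rewrite ger_pMl //; case: (leP a 1) => a1.
    rewrite mulfK //; case: ifP => [|_]; first lra.
    by case: ifP => // h; lra.
  rewrite divff //; case: ifP => [|_]; first lra.
  by case: ifP => // /negP; lra.
by rewrite (ltW d0) mul0r oppr_le0 a0.
Qed.

Lemma distN_val q : distN⟨q⟩ = distK (val q).
Proof.
rewrite distNE val_code ιD ι_monus (_ : ι (msnd q) + 1 = ι (mden q)); last first.
  by rewrite /mden !ιE.
have d0 := den_gt0 q; have dn := lt0r_neq0 d0; rewrite /distK.
have [a [a0 [[-> [-> ->]]|[-> [-> ->]]]]] := val_cases q.
  rewrite ger_pMl // add0r; case: (leP a 1) => a1.
    rewrite mul0r; case: ifP => [|_]; first lra.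
    by case: ifP => // h; lra.
  rewrite mulrBl mulfK // divff //; case: ifP => [|_]; first lra.
  by case: ifP => // /negP; lra.
by rewrite (ltW d0) addr0 mulfK // oppr_le0 a0 opprK.
Qed.

Lemma clampN_lip : lipschitz clampN.
Proof.
move=> q r; rewrite !clampN_val /clampK ler_norml.
by have [h|/ltW h] := leP 0 (val q - val r); rewrite ?(ger0_norm h) ?(ler0_norm h);
  do ?(case: ifP => [|/negP] ?); lra.
Qed.

Lemma distN_lip : lipschitz distN.
Proof.
move=> q r; rewrite !distN_val /distK ler_norml.
by have [h|/ltW h] := leP 0 (val q - val r); rewrite ?(ger0_norm h) ?(ler0_norm h);
  do ?(case: ifP => [|/negP] ?); lra.
Qed.

Definition clamp (x : N1) : N1 := app (mcomp clampN) x.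
Definition dist (x : N1) : N1 := app (mcomp distN) x.

Lemma clampE x n : (clamp x)⟨n⟩ = clampK (x⟨n⟩).
Proof. by rewrite mcompE clampN_val. Qed.

Lemma distE x n : (dist x)⟨n⟩ = distK (x⟨n⟩).
Proof. by rewrite mcompE distN_val. Qed.

Lemma mzeroRE n : mzeroR⟨n⟩ = 0.
Proof.
rewrite teval_lam !tevalE -/zero.
have -> : mpair (teval (econs n void) 0%tm) (teval (econs n void) 0%tm) = mcode zero zero.
  by rewrite /mcode; congr (mpair _ _); apply: ι_inj; rewrite !ιE addr0.
by rewrite val_code ι0 mul0r.
Qed.

Lemma moneRE n : moneR⟨n⟩ = 1.
Proof.
rewrite teval_lam !tevalE.
have -> : mpair (teval (econs n void) (num 2)) (teval (econs n void) 0%tm) = mcode one zero.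
  by rewrite /mcode; congr (mpair _ _); apply: ι_inj; rewrite /= -/(add _ _) !ιE; lra.
by rewrite val_code ι0 ι1 add0r divr1.
Qed.

Lemma min01P x : min01 x <-> mreal x /\ forall n, - (2 / e n) <= x⟨n⟩ <= 1 + 2 / e n.
Proof.
rewrite /min01; split=> -[xr].
  move=> [h0 h1]; split=> // n; apply/andP; split; rewrite leNgt; apply/negP => h.
    by apply: h0; apply/ltRP; exists n; rewrite mzeroRE; lra.
  by apply: h1; apply/ltRP; exists n; rewrite moneRE; lra.
move=> h; split=> //; split=> /ltRP [n]; rewrite ?mzeroRE ?moneRE;
  by case/andP: (h n) => ? ?; lra.
Qed.

Lemma clampK_bounds v : 0 <= clampK v <= 1.
Proof. by rewrite /clampK; do ?(case: ifP => [|/negP] ?); lra. Qed.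

Lemma inv_exp2_gt0 (C : K) n : 0 < C -> 0 < C / e n.
Proof. by move=> C0; rewrite divr_gt0 ?exp2_gt0. Qed.

Lemma clamp_real x : mreal x -> mreal (clamp x).
Proof. exact: lipschitz_real clampN_lip. Qed.

Lemma dist_real x : mreal x -> mreal (dist x).
Proof. exact: lipschitz_real distN_lip. Qed.

Lemma clamp_eqR x y : meqR x y -> meqR (clamp x) (clamp y).
Proof. exact: lipschitz_eqR clampN_lip. Qed.

Lemma dist_eqR x y : meqR x y -> meqR (dist x) (dist y).
Proof. exact: lipschitz_eqR distN_lip. Qed.

Lemma clamp_in01 x : mreal x -> min01 (clamp x).
Proof.
move=> xr; apply/min01P; split=> [|n]; first exact: clamp_real.
rewrite clampE; have := inv_exp2_gt0 n (ltr0n K 2).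
by case/andP: (clampK_bounds (x⟨n⟩)); lra.
Qed.

Lemma in01_clamp x : min01 x -> meqR (clamp x) x.
Proof.
move=> /min01P [xr h]; apply/eqRP => n; rewrite clampE /clampK ler_norml.
have := inv_exp2_gt0 n (ltr0n K 2); case/andP: (h n).
by do ?(case: ifP => [|/negP] ?); lra.
Qed.

Lemma in01_dist x : min01 x -> meqR (clamp (dist x)) mzeroR.
Proof.
move=> /min01P [xr h]; apply/eqRP => n; rewrite clampE distE mzeroRE ler_norml.
have := inv_exp2_gt0 n (ltr0n K 2); case/andP: (h n).
by rewrite /distK; do ?(case: ifP => [|/negP] ?); rewrite /clampK;
  do ?(case: ifP => [|/negP] ?); lra.
Qed.

Lemma dist_clamp x : mreal x -> meqR (clamp (dist x)) mzeroR -> meqR x (clamp x).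
Proof.
move=> xr /eqRP h; apply: (eqR_large (C := 2) (k := two)) => //; first exact: clamp_real.
move=> n n2; have := h n; rewrite clampE distE mzeroRE subr0 clampE.
(* From index 2 on the tolerance is below 1. So the projected distance has not been cut off at 1 and
   is the true distance from [0,1], which bounds the difference between x and its projection. *)
have : 2 / e n < 1.
  by rewrite ltr_pdivrMr ?exp2_gt0 // mul1r; have := exp2_gt n; rewrite ι_two in n2; lra.
rewrite !ler_norml.
by rewrite /distK; do ?(case: ifP => [|/negP] ?); rewrite /clampK;
  do ?(case: ifP => [|/negP] ?); lra.
Qed.

Lemma mzeroR_real : mreal mzeroR.
Proof. by apply/realP => m n _; rewrite !mzeroRE subrr normr0 inv_exp2_gt0. Qed.

Lemma mzeroR_in01 : min01 mzeroR.
Proof.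
apply/min01P; split=> [|n]; first exact: mzeroR_real.
by rewrite mzeroRE; have := inv_exp2_gt0 n (ltr0n K 2); lra.
Qed.

Definition meqb a b := mmonus one (add (mmonus a b) (mmonus b a)).
Definition mltb a b := mmonus one (mmonus (add a one) b).
Definition eqbT V (a b : tm V tO) : tm V tO := monus 1 (monus a b + monus b a)%tm.
Definition ltbT V (a b : tm V tO) : tm V tO := monus 1 (monus (a + 1)%tm b).

Lemma teval_eqb V (ρ : env M V) a b :
  teval ρ (eqbT a b) = meqb (teval ρ a) (teval ρ b).
Proof. by rewrite /eqbT !tevalE. Qed.

Lemma teval_ltb V (ρ : env M V) a b :
  teval ρ (ltbT a b) = mltb (teval ρ a) (teval ρ b).
Proof. by rewrite /ltbT !tevalE. Qed.

Lemma ι_eqb a b : ι (meqb a b) = if ι a == ι b then 1 else 0.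
Proof.
rewrite /meqb; case: (monusP a b) => -[h1 e1]; case: (monusP b a) => -[h2 e2];
  case: (monusP one (add (mmonus a b) (mmonus b a))) => -[+ ->]; rewrite ιD e1 e2 ι1;
  case: (ltgtP (ι a) (ι b)) => [/ι_lt_succ|/ι_lt_succ|]; lra.
Qed.

Lemma ι_ltb a b : ι (mltb a b) = if ι a < ι b then 1 else 0.
Proof.
rewrite /mltb; case: (monusP (add a one) b) => -[h hE];
  case: (monusP one (mmonus (add a one) b)) => -[+ ->]; move: h; rewrite hE ιD ι1;
  case: (ltP (ι a) (ι b)) => [/ι_lt_succ|]; lra.
Qed.

Lemma meqb_eq a b : a = b -> meqb a b = one.
Proof. by move=> ->; apply: ι_inj; rewrite ι_eqb eqxx ι1. Qed.

Lemma meqb_one a b : meqb a b = one -> a = b.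
Proof.
move=> /(congr1 ι); rewrite ι_eqb ι1; case: eqP => [/ι_inj //|_ /eqP].
by rewrite eq_sym oner_eq0.
Qed.

(** * Pigeonhole, diagonalization, and the use of Korg_1 *)

Section Pigeonhole.
Variables (F : N1) (k : N).
Hypotheses (F_inj : forall m n, app F m = app F n -> m = n) (F_le : forall n, ι (app F n) <= ι k).

(** The number of i < n with F(i) = j, computed inside the model; in the recursion step [#2] is j,
    [#1] is i and [#0] the count so far. In [count_lt] the condition is F(i) < j. *)
Definition count_eq (j n : N) : N :=
  rec (app (teval self (lam (lam (lam (#0 + eqbT (Var (old (old (old F))) · #1) #2))))%tm) j)
    zero n.
Definition count_lt (j n : N) : N :=
  rec (app (teval self (lam (lam (lam (#0 + ltbT (Var (old (old (old F))) · #1) #2))))%tm) j)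
    zero n.

Lemma count_eqS j n : ι (count_eq j (add n one)) =
  ι (count_eq j n) + if ι (app F n) == ι j then 1 else 0.
Proof.
rewrite {1}/count_eq recS -/(count_eq j n) !teval_lam teval_add teval_eqb teval_app.
by rewrite ιD ι_eqb.
Qed.

Lemma count_ltS j n : ι (count_lt j (add n one)) =
  ι (count_lt j n) + if ι (app F n) < ι j then 1 else 0.
Proof.
rewrite {1}/count_lt recS -/(count_lt j n) !teval_lam teval_add teval_ltb teval_app.
by rewrite ιD ι_ltb.
Qed.

Lemma count_eq0 j : count_eq j zero = zero. Proof. exact: rec0. Qed.
Lemma count_lt0 j : count_lt j zero = zero. Proof. exact: rec0. Qed.

(** The preimage [i] of [j], if there is one, is chosen before the induction and enters as a
    parameter, so the predicate stays quantifier-free: the count is 0 up to [i] and 1 afterwards. *)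
Lemma count_eq_le1 j n : ι (count_eq j n) <= 1.
Proof.
have [[i iP]|no] := EM (exists i, app F i = j).
  suff [h1 h2] : (leq n i -> count_eq j n = zero) /\ (less i n -> count_eq j n = one).
    case: (less_total n i) => h; first by rewrite h1 ?ι0 //; left.
      by rewrite h1 ?ι0 //; right.
    by rewrite h2 ?ι1.
  apply: (model_ind (P := fun n => (less n i \/ n = i -> count_eq j n = zero) /\
    (less i n -> count_eq j n = one))).
  - qf.
  - split=> [_|/ι_less]; first exact: count_eq0.
    by rewrite ι0 => /(le_lt_trans (ι_ge0 i)); rewrite ltxx.
  - move=> {}n [IH1 IH2]; split=> h; apply: ι_inj; rewrite count_eqS.
      have ni : ι n < ι i by have /ι_leq := h; rewrite ιD ι1; lra.
      rewrite IH1; last by left; apply/ι_less.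
      by rewrite ifF ?addr0 //; apply/eqP => /ι_inj hE; move: ni;
        rewrite (F_inj (etrans hE (esym iP))) ltxx.
    case/less_succ: h => [h|ni].
      rewrite IH2 // ι1 ifF ?addr0 //; apply/eqP => /ι_inj hE.
      by move/ι_less: h; rewrite (F_inj (etrans hE (esym iP))) ltxx.
    by rewrite IH1 ?ι0 ?ι1 ?add0r -?ni ?iP ?eqxx //; right.
suff -> : count_eq j n = zero by rewrite ι0 ler01.
apply: (model_ind (P := fun n => count_eq j n = zero)).
- qf.
- exact: count_eq0.
- move=> {}n IH; apply: ι_inj; rewrite count_eqS IH ifF ?addr0 //.
  by apply/eqP => /ι_inj hE; apply: no; exists n.
Qed.

Lemma count_lt_succ j n : count_lt (add j one) n = add (count_lt j n) (count_eq j n).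
Proof.
apply: (model_ind (P := fun n =>
  count_lt (add j one) n = add (count_lt j n) (count_eq j n))).
- qf.
- by rewrite !count_lt0 count_eq0; apply: ι_inj; rewrite !ιE addr0.
- move=> {}n /(congr1 ι); rewrite ιD => IH; apply: ι_inj.
  rewrite ιD !count_ltS count_eqS IH ιD ι1.
  case: (ltgtP (ι (app F n)) (ι j)) => [|/ι_lt_succ|]; case: ifP => [|/negP] ?; lra.
Qed.

(** Raising the bound from j to j + 1 adds the count of the value j, which is at most 1 by
    injectivity. *)
Lemma count_lt_le j n : ι (count_lt j n) <= ι j.
Proof.
apply/ι_leq.
apply: (model_ind (P := fun j => less (count_lt j n) j \/ count_lt j n = j)).
- qf.
- right; apply: (model_ind (P := fun n => count_lt zero n = zero)).
  + qf.
  + exact: count_lt0.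
  + move=> {}n /(congr1 ι) IH; apply: ι_inj; rewrite count_ltS IH ι0.
    by have := ι_ge0 (app F n); case: ifP; lra.
- move=> {}j /ι_leq IH; apply/ι_leq; rewrite count_lt_succ !ιD ι1.
  by have := count_eq_le1 j n; lra.
Qed.

(** All values are below k + 1, so the count below k + 1 among the first k + 2 arguments is k + 2,
    yet it is at most k + 1. *)
Lemma pigeonhole : False.
Proof.
have cE n : count_lt (add k one) n = n.
  apply: (model_ind (P := fun n => count_lt (add k one) n = n)).
  - qf.
  - exact: count_lt0.
  - move=> {}n IH; apply: ι_inj; rewrite count_ltS IH !ιD ι1.
    by have := F_le n; case: ifP => [|/negP] ?; lra.
by have := count_lt_le (add k one) (add (add k one) one); rewrite cE !ιD ι1; lra.
Qed.

End Pigeonhole.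

Section Diagonal.
Variable a : dom M (tO ⇾ t1).

(** The index 2n + 5 makes the tolerance 2 / 2^(2n+5) of real equality one quarter of 4^-(n+1), the
    unit of the digit to be chosen. *)
Definition diag_index n : N := add (add n n) (add two (add two one)).
Definition diag_approx n : N := app clampN (app (app a n) (diag_index n)).
(** The test asks whether the approximation lies left of the midpoint (4s + 2) / 4^(n+1) of the
    interval from s / 4^n to (s + 1) / 4^n; denominators are cleared so that numbers are
    compared. *)
Definition diag_dig (n s : N) : N :=
  mltb (mul (mpos (diag_approx n)) (mexp2 (add (add n one) (add n one))))
    (mul (add (add (add s s) (add s s)) two) (mden (diag_approx n))).

(* [diag_num n] / 4 ^ n is the [n]-th approximation; the next digit in base 4 is 0 or 3,
   whichever keeps away from the [n]-th member of the sequence. *)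
Definition diag_step : dom M (tO ⇾ tO ⇾ tO) := teval self (lam (lam
  (let r4 := (#0 + #0) + (#0 + #0) in
   let q := Var (old (old clampN)) · (Var (old (old a)) · #1 ·
     ((#1 + #1) + (num 2 + (num 2 + 1)))) in
   let t := ltbT (pos q * exp2 ((#1 + 1) + (#1 + 1))) ((r4 + num 2) * den q) in
   r4 + (t + (t + t)))%tm)).
Definition diag_num n : N := rec diag_step zero n.
Definition diag : N1 := teval self (lam
  (let s := Cst cRec · Var (old diag_step) · 0 · #0 in
   pairN (s + s) (monus (exp2 (#0 + #0)) 1))%tm).

Lemma diag_num0 : diag_num zero = zero. Proof. exact: rec0. Qed.

Lemma diag_numS n : diag_num (add n one) =
  (let s := diag_num n in let t := diag_dig n s in
   add (add (add s s) (add s s)) (add t (add t t))).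
Proof.
rewrite /diag_num recS -/(diag_num n) !teval_lam.
rewrite !(teval_add, teval_ltb, teval_mul, teval_pos, teval_den, teval_exp2, teval_app).
by [].
Qed.

Lemma diagE n : diag⟨n⟩ = ι (diag_num n) / e (add n n).
Proof.
rewrite teval_lam !tevalE -/(mcode _ _).
rewrite [X in val X](_ : _ = mcode (diag_num n) (mmonus (mexp2 (add n n)) one)) //.
rewrite val_code ι_monus ι1; have := exp2_gt (add n n); have := ι_ge0 (add n n).
by case: ifP => [|_] *; congr (_ / _); lra.
Qed.

(** This is why the approximation is projected to [0,1]: the digit test can then ignore negative
    parts. *)
Lemma clampN_neg q : mneg (app clampN q) = zero.
Proof. by rewrite clampNE mneg_code. Qed.

Lemma diag_numS_cases n : let g := e (add (add n one) (add n one)) in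
  let r := val (diag_approx n) in let s := ι (diag_num n) in
  (r < (4 * s + 2) / g /\ ι (diag_num (add n one)) = 4 * s + 3) \/
  ((4 * s + 2) / g <= r /\ ι (diag_num (add n one)) = 4 * s).
Proof.
rewrite /= diag_numS /=; set s := diag_num n; set g := e _.
have g0 : 0 < g by exact: exp2_gt0.
have d0 := den_gt0 (diag_approx n).
have rE : (val (diag_approx n) < (4 * ι s + 2) / g) =
    (ι (mpos (diag_approx n)) * g < (4 * ι s + 2) * ι (mden (diag_approx n))).
  rewrite /val clampN_neg ι0 subr0 ltr_pdivrMr // mulrAC ltr_pdivlMr //.
have tE : ι (diag_dig n s) = if val (diag_approx n) < (4 * ι s + 2) / g then 1 else 0.
  rewrite /diag_dig ι_ltb [ι (mul (mpos _) _)]ιM [ι (mul (add _ _) _)]ιM -/g rE.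
  congr (if _ < _ * _ then _ else _).
  by rewrite !ιE; lra.
rewrite !ιD tE; case: ltP => _; [left|right]; split=> //; lra.
Qed.

(** The intervals from s / 4^n to (s + 1) / 4^n, with s = [diag_num n], are nested; multiplied by
    their denominators, the inclusions become inequalities of numbers, fit for induction. *)
Lemma diag_num_bounds n i :
  ι (diag_num n) * e (add i i) <= ι (diag_num (add n i)) /\
  ι (diag_num (add n i)) + 1 <= (ι (diag_num n) + 1) * e (add i i).
Proof.
suff [/ι_leq h1 /ι_leq h2] :
    leq (mul (diag_num n) (mexp2 (add i i))) (diag_num (add n i)) /\
    leq (add (diag_num (add n i)) one) (mul (add (diag_num n) one) (mexp2 (add i i))).
  by move: h1 h2; rewrite !ιM !(ιD _ one) ι1.
apply: (model_ind (P := fun i =>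
  (less (mul (diag_num n) (mexp2 (add i i))) (diag_num (add n i)) \/
   mul (diag_num n) (mexp2 (add i i)) = diag_num (add n i)) /\
  (less (add (diag_num (add n i)) one) (mul (add (diag_num n) one) (mexp2 (add i i))) \/
   add (diag_num (add n i)) one = mul (add (diag_num n) one) (mexp2 (add i i))))).
- qf.
- have -> : add zero zero = zero by apply: ι_inj; rewrite !ιE addr0.
  have -> : add n zero = n by apply: ι_inj; rewrite !ιE addr0.
  by rewrite mexp20; split; right; apply: ι_inj; rewrite !ιE mulr1.
- move=> {}i [/ι_leq IH1 /ι_leq IH2]; rewrite -!/(leq _ _) !ι_leq.
  have -> : add n (add i one) = add (add n i) one by apply: ι_inj; rewrite !ιE addrA.
  have -> : add (add i one) (add i one) = add (add (add i i) one) one.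
    by apply: ι_inj; rewrite !ιE; lra.
  rewrite !ιM !(ιD _ one) ι1 !exp2S in IH1 IH2 *.
  by case: (diag_numS_cases (add n i)) => -[_]; lra.
Qed.

Lemma diag_bounds m n : ι m <= ι n ->
  diag⟨m⟩ <= diag⟨n⟩ /\ diag⟨n⟩ + 1 / e (add n n) <= diag⟨m⟩ + 1 / e (add m m).
Proof.
move=> /leq_add_sub [i ->]; have [h1 h2] := diag_num_bounds m i; rewrite !diagE.
have eE : e (add (add m i) (add m i)) = e (add m m) * e (add i i).
  by rewrite -exp2D; congr (e _); apply: ι_inj; rewrite !ιE; lra.
have [m0 i0] := (exp2_gt0 (add m m), exp2_gt0 (add i i)).
have mi0 : 0 < e (add m m) * e (add i i) by rewrite mulr_gt0.
have scale x : x / e (add m m) = x * e (add i i) / (e (add m m) * e (add i i)).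
  by field; rewrite !lt0r_neq0.
by rewrite eE -!mulrDl !scale !ler_pM2r ?invr_gt0.
Qed.

Lemma inv_exp2_double n : 1 / e (add n n) <= 1 / e n.
Proof.
rewrite !div1r lef_pV2 ?posrE ?exp2_gt0 //; apply: exp2_mono.
by have := ι_ge0 n; rewrite ιD; lra.
Qed.

Lemma diag_real : mreal diag.
Proof.
apply/realP => m n /diag_bounds [h1 h2]; have := inv_exp2_double m.
by have := inv_exp2_gt0 (add n n) (ltr0n K 1); rewrite ltr_norml; lra.
Qed.

Lemma diag_in01 : min01 diag.
Proof.
apply/min01P; split=> [|n]; first exact: diag_real.
have /diag_bounds [] : ι zero <= ι n by rewrite ι0 ι_ge0.
have -> : add zero zero = zero by apply: ι_inj; rewrite !ιE addr0.
have := inv_exp2_gt0 (add n n) (ltr0n K 1); have := inv_exp2_gt0 n (ltr0n K 2).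
rewrite [diag⟨zero⟩]diagE diag_num0 ι0 mul0r mexp20 ι1; lra.
Qed.

Lemma diag_neq n : ~ meqR diag (clamp (app a n)).
Proof.
move=> /eqRP /(_ (diag_index n)); rewrite mcompE -/(diag_approx n).
set m := diag_index n; set n1 := add n one; set g := 1 / e (add n1 n1).
have n0 := ι_ge0 n.
have n1m : ι n1 <= ι m by rewrite !ιE; lra.
have [h1 h2] := diag_bounds n1m.
have g0 : 0 < g by exact: inv_exp2_gt0.
have gm : 2 / e m = g / 4.
  have -> : m = add (add (add (add n1 n1) one) one) one.
    by apply: ι_inj; rewrite !ιE; lra.
  by rewrite !exp2S /g; field; rewrite exp2_neq0.
have m0 : 0 < 1 / e (add m m) by exact: inv_exp2_gt0.
have scale x : x / e (add n1 n1) = x * g by rewrite /g div1r.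
rewrite gm ler_norml => /andP[k1 k2]; rewrite [diag⟨n1⟩]diagE !scale in h1 h2.
by case: (diag_numS_cases n); rewrite -/n1 scale => -[h3 h4]; rewrite h4 in h1 h2; lra.
Qed.

End Diagonal.

(** * From a bijection and Korg_1 to a contradiction *)

Section NoBijection.
Variable Y : dom M t2.
Hypotheses
  (Y_ext : forall x y, min01 x -> min01 y -> meqR x y -> app Y x = app Y y)
  (Y_inj : forall x y, min01 x -> min01 y -> app Y x = app Y y -> meqR x y)
  (Y_surj : forall n, exists x, min01 x /\ app Y x = n).

Definition in_unit (x : N1) : N := meqb (app Y (clamp (dist x))) (app Y mzeroR).

Lemma in_unit01 x : min01 x -> in_unit x = one.
Proof.
move=> x01; have [xr _] := x01; apply/meqb_eq/Y_ext; last exact: in01_dist.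
  exact/clamp_in01/dist_real.
exact: mzeroR_in01.
Qed.

Lemma in_unit_clamp x : mreal x -> in_unit x = one -> meqR x (clamp x).
Proof.
move=> xr /meqb_one h; apply: dist_clamp => //; apply: Y_inj h; last exact: mzeroR_in01.
exact/clamp_in01/dist_real.
Qed.

Lemma in_unit_ext x y : mreal x -> mreal y -> meqR x y -> in_unit x = in_unit y.
Proof.
move=> xr yr xy; congr meqb; apply: Y_ext; [exact/clamp_in01/dist_real..|].
exact/clamp_eqR/dist_eqR.
Qed.

(** Extends [Y] from [0,1] to all reals in a way that respects equality everywhere, as the
    functionals in Korg_1 must. *)
Definition index (x : N1) : N := app Y (clamp x).

Lemma index_ext x y : mreal x -> mreal y -> meqR x y -> index x = index y.
Proof.
by move=> xr yr xy; apply: Y_ext; [exact: clamp_in01..|exact: clamp_eqR].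
Qed.

Lemma index_inj x y : mreal x -> mreal y -> in_unit x = one -> in_unit y = one ->
  index x = index y -> meqR x y.
Proof.
move=> xr yr xu yu xy; apply: (eqR_trans (y := clamp x)) => //; first exact: in_unit_clamp.
apply: (eqR_trans (y := clamp y)) => //; [exact: clamp_real|..|].
  by apply: Y_inj xy; exact: clamp_in01.
exact/eqR_sym/in_unit_clamp.
Qed.

Lemma index_surj n : exists x, [/\ mreal x, in_unit x = one & index x = n].
Proof.
have [x [x01 xn]] := Y_surj n; have [xr _] := x01; exists x; split=> //.
  exact: in_unit01.
by rewrite -xn; apply: Y_ext => //; [exact: clamp_in01|exact: in01_clamp].
Qed.

Lemma meqb01 m n : meqb m n = zero \/ meqb m n = one.
Proof.
have := ι_eqb m n; case: ifP => _ h; [right|left]; apply: ι_inj; by rewrite h ?ι0 ?ι1.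
Qed.

(** The truth value [b] as a real: the constant sequence with value b / 1. *)
Definition flag (x : N1) (b : N) : Prop :=
  (forall n, app x n = mcode b zero) /\ (b = zero \/ b = one).

Lemma flag_real x b : flag x b -> mreal x.
Proof. by move=> [xb _]; apply/realP => m n _; rewrite !xb subrr normr0 inv_exp2_gt0. Qed.

Lemma flag_eqR x y b : flag x b -> flag y b -> meqR x y.
Proof.
by move=> [xb _] [yb _]; apply/eqRP => n; rewrite xb yb subrr normr0 ltW ?inv_exp2_gt0.
Qed.

(** Index 2 is the first at which a difference of 1 exceeds the tolerance of the order. *)
Lemma two_lt_exp2 : 2 / e two < 1.
Proof. by rewrite ltr_pdivrMr ?exp2_gt0 // mul1r; have := exp2_gt two; rewrite ι_two; lra. Qed.

Lemma flag_pos x b : flag x b -> mltR mzeroR x <-> b = one.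
Proof.
move=> [xb b01]; have xE n : x⟨n⟩ = ι b by rewrite xb val_code ι0 add0r divr1.
rewrite ltRP; split=> [[n]|bE].
  case: b01 => [bE|//]; rewrite mzeroRE xE bE ι0 subrr.
  by rewrite ltNge ltW // inv_exp2_gt0.
by exists two; rewrite mzeroRE xE bE ι1 subr0 two_lt_exp2.
Qed.

Definition in_unitT V (Y' : tm V t2) (c d : tm V (t1 ⇾ t1)) (o x : tm V t1) : tm V tO :=
  eqbT (Y' · (c · (d · x)))%tm (Y' · o)%tm.

Definition unit_set : dom M (t1 ⇾ t1) := teval self (lam (lam
  (let b := in_unitT (Var (old (old Y))) (Var (old (old (mcomp clampN))))
     (Var (old (old (mcomp distN)))) (Var (old (old mzeroR))) #1%tm in
   pairN (b + b) 0)%tm)).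

(** Here [#2] is n, [#1] is the point and [#0] the index of the constant sequence. The product is a
    conjunction of truth values, and adding 1 to the value of [Y] makes the family start at n =
    1. *)
Definition fibre : dom M (tO ⇾ t1 ⇾ t1) := teval self (lam (lam (lam
  (let b := (in_unitT (Var (old (old (old Y)))) (Var (old (old (old (mcomp clampN)))))
     (Var (old (old (old (mcomp distN))))) (Var (old (old (old mzeroR)))) #1 *
     eqbT (Var (old (old (old Y))) · (Var (old (old (old (mcomp clampN)))) · #1) + 1) #2)%tm in
   pairN (b + b) 0)%tm))).

Definition total_rel : dom M (t1 ⇾ t1 ⇾ t1) := teval self (lam (lam oneR)).

Definition in_fibre n x := mul (in_unit x) (meqb (add (index x) one) n).

Lemma unit_set_flag x : flag (app unit_set x) (in_unit x).
Proof.
split=> [n|]; last exact: meqb01.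
by rewrite !teval_lam !(tevalE, teval_eqb).
Qed.

Lemma fibre_flag n x : flag (app (app fibre n) x) (in_fibre n x).
Proof.
split=> [k|].
  by rewrite !teval_lam !(tevalE, teval_eqb).
rewrite /in_fibre; case: (meqb01 (app Y (clamp (dist x))) (app Y mzeroR)) => h.
  by left; apply: ι_inj; rewrite ιM [in_unit x]h ι0 mul0r.
case: (meqb01 (add (index x) one) n) => ->; [left|right];
  by apply: ι_inj; rewrite ιM [in_unit x]h !ιE ?mulr0 ?mulr1.
Qed.

Lemma mem_unit_set x : mmem x unit_set <-> mreal x /\ in_unit x = one.
Proof. by rewrite /mmem (flag_pos (unit_set_flag x)). Qed.

Lemma mem_fibre n x : mmem x (app fibre n) <->
  [/\ mreal x, in_unit x = one & add (index x) one = n].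
Proof.
rewrite /mmem (flag_pos (fibre_flag n x)) /in_fibre; split=> [[xr h]|[xr -> ->]]; last first.
  by split=> //; rewrite meqb_eq //; apply: ι_inj; rewrite !ιE mulr1.
have u1 : in_unit x = one.
  case: (meqb01 (app Y (clamp (dist x))) (app Y mzeroR)) => // u0; move: (congr1 ι h).
  by rewrite ιM [in_unit x]u0 ι0 mul0r ι1 => /eqP; rewrite eq_sym oner_eq0.
split=> //; apply: meqb_one; apply: ι_inj.
by move: (congr1 ι h); rewrite u1 ιM ι1 mul1r.
Qed.

Lemma unit_set_fun : mfunRR unit_set.
Proof.
split=> [x _|x y xr yr xy]; first exact: flag_real (unit_set_flag x).
apply: flag_eqR (unit_set_flag x) _; rewrite (in_unit_ext xr yr xy).
exact: unit_set_flag.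
Qed.

Lemma fibre_fun n : mfunRR (app fibre n).
Proof.
split=> [x _|x y xr yr xy]; first exact: flag_real (fibre_flag n x).
apply: flag_eqR (fibre_flag n x) _.
rewrite /in_fibre (in_unit_ext xr yr xy) (index_ext xr yr xy).
exact: fibre_flag.
Qed.

(** The points 1 / (n + 1), an injection of the numbers into [0,1], show that the unit interval is
    infinite: an injection of [0,1] into a bounded set of numbers would contradict the pigeonhole
    principle. *)
Definition reciprocal n : N1 := teval (econs n self) (lam (pairN (1 + 1)%tm #1%tm)).

Lemma reciprocalE n k : (reciprocal n)⟨k⟩ = 1 / (ι n + 1).
Proof. by rewrite teval_lam !tevalE -/(mcode one n) val_code ι1. Qed.

Lemma reciprocal_in01 n : min01 (reciprocal n).
Proof.
have n0 := ι_ge0 n; have h : 0 <= 1 / (ι n + 1) <= 1.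
  have d0 := ι_succ_gt0 n; apply/andP; split; first by rewrite divr_ge0 // ltW.
  by rewrite ler_pdivrMr // mul1r; lra.
apply/min01P; split=> [|k]; last first.
  by rewrite reciprocalE; have := inv_exp2_gt0 k (ltr0n K 2); lra.
by apply/realP => k l _; rewrite !reciprocalE subrr normr0 inv_exp2_gt0.
Qed.

Lemma unit_set_infinite : ~ mfinite unit_set.
Proof.
move=> [k [Z [Z_ext [Z_inj Z_le]]]].
pose F : N1 := teval self (lam (Var (old Z) · lam (pairN (1 + 1) #1))%tm).
have FE n : app F n = app Z (reciprocal n) by rewrite teval_lam.
have mem n : mmem (reciprocal n) unit_set.
  by apply/mem_unit_set; split; [have [] := reciprocal_in01 n|exact/in_unit01/reciprocal_in01].
apply: (@pigeonhole F k) => [m n|n]; rewrite !FE; last exact/ι_leq/Z_le.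
move=> /(Z_inj _ _ (mem m) (mem n)) /eqRP h; apply: ι_inj.
have := ler_exp2_eq0 (a := 1 / (ι m + 1) - 1 / (ι n + 1)).
move=> /(_ (fun i => _)) h'.
(* Both reals are constant sequences, so their difference is bounded by 2 / 2^i for every i and
   vanishes. *)
have {h'} : 1 / (ι m + 1) - 1 / (ι n + 1) = 0.
  by apply: h' => i; have := h i; rewrite !reciprocalE.
rewrite !div1r => /eqP; rewrite subr_eq0 => /eqP /invr_inj; lra.
Qed.

Lemma total_relE x y : app (app total_rel x) y = moneR.
Proof. by rewrite !teval_lam teval_oneR. Qed.

Lemma related_total x y : mrelated total_rel x y.
Proof.
rewrite /mrelated total_relE; apply/ltRP; exists two.
by rewrite mzeroRE moneRE subr0 two_lt_exp2.
Qed.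

Lemma moneR_real : mreal moneR.
Proof. by apply/realP => m n _; rewrite !moneRE subrr normr0 inv_exp2_gt0. Qed.

(** A fibre has at most one point, so the constant function 0 is injective on it, with bound 0. *)
Lemma fibre_finite n : mfinite (app fibre n).
Proof.
exists zero, (app (const (cK tO t1)) zero); split=> [x y _ _ _|]; first by rewrite !app_K.
split=> [x y /mem_fibre [xr xu xn] /mem_fibre [yr yu yn] _|x _].
  apply: index_inj => //; apply: ι_inj; move: (congr1 ι (etrans xn (esym yn))).
  by rewrite !(ιD _ one); lra.
by rewrite app_K; right.
Qed.

Lemma fibre_nonempty n : leq one n -> exists x, mmem x (app fibre n).
Proof.
move=> /mmonusK nE; have [x [xr xu xn]] := index_surj (mmonus n one).
by exists x; apply/mem_fibre; rewrite xn.
Qed.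

Lemma no_bijection : mKorg1 -> False.
Proof.
move=> korg; have [|a aP] := korg unit_set total_rel fibre.
  split; first exact: unit_set_fun.
  split; first exact: unit_set_infinite.
  split.
    exists (teval self (lam (Var (old Y) · (Var (old (mcomp clampN)) · #0))%tm)).
    have E x : app (teval self (lam (Var (old Y) · (Var (old (mcomp clampN)) · #0))%tm)) x
        = index x by rewrite teval_lam.
    split=> [x y xr yr xy|]; first by rewrite !E; exact: index_ext.
    split=> [x y /mem_unit_set [xr xu] /mem_unit_set [yr yu]|n].
      by rewrite !E; exact: index_inj.
    have [x [xr xu xn]] := index_surj n; exists x; rewrite E; split=> //.
    exact/mem_unit_set.
  split.
    split=> [x y _ _|x y z _ _ _ _]; rewrite !total_relE; first exact: moneR_real.
    by split; exact: eqR_refl.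
  split=> [x y _ _ _|]; first exact: related_total.
  split; last first.
    move=> n n1 x _; have [y yP] := fibre_nonempty n1; exists y; split=> //.
    exact: related_total.
  split=> [n n1|x].
    by split; [exact: fibre_fun|split; [exact: fibre_nonempty|exact: fibre_finite]].
  split=> [/mem_unit_set [xr xu]|[n [_ /mem_fibre [xr xu _]]]]; last exact/mem_unit_set.
  exists (add (index x) one); split; last exact/mem_fibre.
  by apply/ι_leq; rewrite ιD ι1; have := ι_ge0 (index x); lra.
(* The shift undoes the numbering from 1: the [index] of [b n] is n. *)
pose b : dom M (tO ⇾ t1) := teval self (lam (Var (old a) · (#0 + 1))%tm).
have bE n : app b n = app a (add n one) by rewrite teval_lam.
(* The diagonal is compared with the member of the sequence numbered by its own [Y]-value; both have
   this value, so injectivity would make them equal. *)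
apply: (@diag_neq b (app Y (diag b))).
have [|/mem_fibre [] ] := aP (add (app Y (diag b)) one).
  by apply/ι_leq; rewrite ιD ι1; have := ι_ge0 (app Y (diag b)); lra.
rewrite -bE => xr xu xn _; apply: Y_inj; [exact: diag_in01|exact: clamp_in01|].
apply: ι_inj; move: (congr1 ι xn); rewrite !(ιD _ one) /index; lra.
Qed.

End NoBijection.

End Model.

Lemma model_Korg1_NBI (M : structure) :
  extensional M -> satisfies M RCA0w -> mKorg1 M -> mNBI M.
Proof.
move=> Mext Msat korg Y Y_ext; apply: contrapT => /not_orP [ninj nsurj].
have [K [ι [[ι0 ι1] ιD ιM ιlt ιarch]]] := osemiring_embeds (model_osemiring Mext Msat).
apply: (no_bijection Mext Msat ι0 ι1 ιD ιM ιlt ιarch Y_ext _ _ korg).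
  move=> x y x01 y01 xy; apply: contrapT => nxy; apply: ninj.
  by exists x, y.
move=> n; apply: contrapT => nx; apply: nsurj; exists n => x x01 xn.
by apply: nx; exists x.
Qed.

Theorem theorem3p23 : RCA0w_proves (Korg1 ⟶ NBI)%fm.
Proof.
apply: completeness => M ρ Mext Msat.
have -> : ρ = void M.
  by apply: functional_extensionality_dep => τ; apply: functional_extensionality_dep => -[].
change (feval (void M) Korg1 -> feval (void M) NBI).
rewrite feval_Korg1 // feval_NBI //; exact: model_Korg1_NBI.
Qed.
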